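(* Let $\mathfrak{g}=\mathfrak{s}\oplus_\rho R$ be a Levi decomposition, compatible with the grading, of the Lie algebra $\mathfrak{g}$ of infinitesimal CR automorphisms of a non-degenerate quadric model. Let $E_s\in\mathfrak{s}$ be the element providing the grading on $\mathfrak{s}$. Let $W\subset R$ be an irreducible subrepresentation of $\rho$ which decomposes as $W=W_{-2}\oplus\dots\oplus W_{c}$ with respect to the eigenvalues of the Euler field $E$ (where $W_i$ is the $i$-eigenspace, $W_{-2}\ne0$, $W_c\neq 0$). Then: (1) The eigenvalue $K_{max}$ of $\rho(E_s)$ on a highest weight vector of $W$ is the largest eigenvalue of $\rho(E_s)$ on $W$, and the eigenvalue $K_{min}$ of $\rho(E_s)$ on a lowest weight vector of $W$ is the smallest eigenvalue of $\rho(E_s)$ on $W$. (2) $W_i$ is the eigenspace of $\rho(E_s)$ in $W$ with eigenvalue $i+K_{min}+2$, and $c=K_{max}-K_{min}-2$. (3) The infinitesimal CR automorphisms in $W_c$ have weighted degree $K_{max}-K_{min}-2$ and are at least $K$-jet determined, where $K=\lfloor (K_{max}-K_{min})/2\rfloor$.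
   Context: A quadric model is a real submanifold of $\mathbb{C}^{n+k}$ with coordinates $(z,w)\in\mathbb{C}^n\times\mathbb{C}^k$, $1\le k\le n^2$, given by $\operatorname{Im} w_j=zH_jz^*$, $j=1,\dots,k$, with $H_j$ Hermitian $n\times n$ matrices ($^*$ is conjugate transpose). It is non-degenerate if the $H_j$ are linearly independent over $\mathbb{R}$ and have trivial common kernel. An infinitesimal CR automorphism is a germ at $0$ of a holomorphic vector field whose real part is tangent to the quadric; for a non-degenerate quadric model they form a finite-dimensional real Lie algebra $\mathfrak{g}$, containing the Euler field $E=\sum_j z_j\frac{\partial}{\partial z_j}+2\sum_j w_j\frac{\partial}{\partial w_j}$, and graded by the eigenvalues of the adjoint action of $E$: $z_j$ has weight $1$, $w_j$ weight $2$, $\partial_{z_j}$ weight $-1$, $\partial_{w_j}$ weight $-2$, and $\mathfrak{g}_b$ consists of the elements of weighted degree $b$. The lowest degree is $-2$, and $\mathfrak{g}_{-1}\cong\mathbb{C}^n$ carries the complex structure $J$ induced by multiplication by $i$. $R$ is the radical of $\mathfrak{g}$, $\mathfrak{s}\subset\mathfrak{g}$ is a semisimple subalgebra with $\mathfrak{g}=\mathfrak{s}\oplus R$ as vector spaces, and $\rho:\mathfrak{s}\to\mathfrak{gl}(R)$ is the representation induced by the bracket $[\mathfrak{s},R]\subset R$. The Levi decomposition is compatible with the grading if $[E,\mathfrak{s}]\subset\mathfrak{s}$, with $\mathfrak{s}=\mathfrak{s}_{-2}\oplus\dots\oplus\mathfrak{s}_2$, $R=R_{-2}\oplus\dots\oplus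 R_b$ (gradings induced by $E$), $J(\mathfrak{s}_{-1})\subset\mathfrak{s}_{-1}$ and $J(R_{-1})\subset R_{-1}$. The element $E_s\in\mathfrak{s}$ providing the grading on $\mathfrak{s}$ is the sum of the grading elements of the simple factors of $\mathfrak{s}$; thus $[E_s,X]=jX$ for $X\in\mathfrak{s}_j$. Highest and lowest weight vectors are taken (after complexification) with respect to a Cartan subalgebra containing $E_s$ and a positive system for which the root spaces in $\mathfrak{s}_1\oplus\mathfrak{s}_2$ are positive. ''At least $K$-jet determined'' for nonzero infinitesimal CR automorphisms means that at least their $K$-jet at $0$ is needed to distinguish them from $0$, i.e. their $(K-1)$-jet at $0$ vanishes. *)

(* Defs.v *)
From HB Require Import structures.
From mathcomp Require Import all_boot all_order all_algebra.
From mathcomp Require Import all_classical all_reals all_analysis.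
From mathcomp Require Import complex.
Set Implicit Arguments.
Unset Strict Implicit.
Unset Printing Implicit Defensive.
Import Order.TTheory GRing.Theory Num.Theory.
Import numFieldNormedType.Exports.
Local Open Scope classical_set_scope.
Local Open Scope ring_scope.
Local Open Scope complex_scope.

Section Lie.
Variables (K : fieldType) (V : lmodType K) (br : V -> V -> V).
Implicit Types (A B I L S W : set V).

Definition subspace A :=
  A 0 /\ forall (a : K) x y, A x -> A y -> A (a *: x + y).

Definition lspan S : set V :=
  \bigcap_(A in [set A | subspace A /\ S `<=` A]) A.

Definition br_span A B : set V := lspan [set br x y | x in A & y in B].

Definition lie_subalgebra L A :=
  [/\ subspace A, A `<=` L & forall x y, A x -> A y -> A (br x y)].

Definition lie_ideal L I :=
  [/\ subspace I, I `<=` L & forall x y, L x -> I y -> I (br x y)].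

Definition derived_series L (m : nat) : set V :=
  iter m (fun A => br_span A A) L.

Definition lie_solvable L := exists m, derived_series L m = [set 0].

Definition is_radical L (Rad : set V) :=
  [/\ lie_ideal L Rad, lie_solvable Rad &
      forall I, lie_ideal L I -> lie_solvable I -> I `<=` Rad].

Definition lie_simple L :=
  (exists x y, [/\ L x, L y & br x y <> 0]) /\
  forall I, lie_ideal L I -> I = [set 0] \/ I = L.

Definition lie_semisimple L :=
  exists (r : nat) (S : 'I_r -> set V),
    [/\ forall i, lie_ideal L (S i) /\ lie_simple (S i),
        forall x, L x -> exists2 y : 'I_r -> V,
          (forall i, S i (y i)) & x = \sum_i y i &
        forall y : 'I_r -> V,
          (forall i, S i (y i)) -> \sum_i y i = 0 -> forall i, y i = 0].

Definition levi_decomposition L s (Rad : set V) :=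
  [/\ is_radical L Rad, lie_subalgebra L s, lie_semisimple s,
      (forall x, L x -> exists y z, [/\ s y, Rad z & x = y + z]) &
      s `&` Rad = [set 0]].

(* [s] acts on [V] by the bracket. *)
Definition subrep s W :=
  subspace W /\ forall x w, s x -> W w -> W (br x w).

Definition irreducible_subrep s W :=
  [/\ subrep s W, W <> [set 0] &
      forall U, subrep s U -> U `<=` W -> U = [set 0] \/ U = W].

Definition eigensp A (x : V) (mu : K) : set V :=
  [set y | A y /\ br x y = mu *: y].

Definition is_eigenvalue A (x : V) (mu : K) :=
  exists2 y, eigensp A x mu y & y <> 0.

Definition ad_diagonalizable L (x : V) :=
  forall y, L y -> exists (m : nat) (mu : 'I_m -> K) (z : 'I_m -> V),
    (forall i, eigensp L x (mu i) (z i)) /\ y = \sum_i z i.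

Definition toral L h :=
  [/\ subspace h, h `<=` L, forall x y, h x -> h y -> br x y = 0 &
      forall x, h x -> ad_diagonalizable L x].

(* Cartan subalgebra of a semisimple Lie algebra over an algebraically closed
   field: a maximal abelian subalgebra made of ad-diagonalizable elements. *)
Definition cartan_subalgebra L h :=
  toral L h /\ forall h', toral L h' -> h `<=` h' -> h' = h.

(* Functionals on [h] are extended by 0 off [h], so that two functionals that
   agree on [h] are equal as functions. *)
Definition functional_on h (alpha : V -> K) :=
  (forall (a : K) x y, h x -> h y ->
     alpha (a *: x + y) = a * alpha x + alpha y) /\
  forall x, ~ h x -> alpha x = 0.

Definition root_space L h (alpha : V -> K) : set V :=
  [set x | L x /\ forall t, h t -> br t x = alpha t *: x].

Definition roots_of L h : set (V -> K) :=
  [set alpha | [/\ functional_on h alpha, alpha <> 0 &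
                   root_space L h alpha <> [set 0]]].

Definition opp_roots (P : set (V -> K)) : set (V -> K) :=
  [set - alpha | alpha in P].

Definition positive_system L h (P : set (V -> K)) :=
  [/\ roots_of L h = P `|` opp_roots P, P `&` opp_roots P = set0 &
      forall alpha beta, P alpha -> P beta ->
        roots_of L h (alpha + beta) -> P (alpha + beta)].

Definition highest_weight_vector L h (P : set (V -> K)) W (v : V) :=
  [/\ W v, v <> 0,
      exists lambda : V -> K, forall t, h t -> br t v = lambda t *: v &
      forall alpha x, P alpha -> root_space L h alpha x -> br x v = 0].

Definition lowest_weight_vector L h (P : set (V -> K)) W (v : V) :=
  highest_weight_vector L h (opp_roots P) W v.

End Lie.

(* The pair (x, y) stands for x + i y. *)
Definition cplx (R : realType) (V : lmodType R) : Type := (V * V)%type.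

Section Complexification.
Variables (R : realType) (V : lmodType R).

HB.instance Definition _ := GRing.Zmodule.on (cplx V).

Definition cplx_scale (a : R[i]) (p : cplx V) : cplx V :=
  (complex.Re a *: p.1 - complex.Im a *: p.2,
   complex.Re a *: p.2 + complex.Im a *: p.1).

Fact cplx_scaleA a b p :
  cplx_scale a (cplx_scale b p) = cplx_scale (a * b) p.
Proof.
case: a => a1 a2; case: b => b1 b2; case: p => x y.
rewrite /cplx_scale /=; congr (_, _);
  rewrite !(scalerBr, scalerDr, scalerA, scalerBl, scalerDl).
  by rewrite opprD -!addrA; congr (_ + _); rewrite opprD addrA addrC.
by rewrite [X in _ + X]addrC addrACA.
Qed.

Fact cplx_scale1 : left_id 1 cplx_scale.
Proof.
by move=> [x y]; rewrite /cplx_scale /= !scale1r !scale0r subr0 addr0.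
Qed.

Fact cplx_scaleDr : right_distributive cplx_scale +%R.
Proof.
move=> [a1 a2] [x y] [u v]; rewrite /cplx_scale /=; congr (_, _) => /=.
  by rewrite !scalerDr opprD addrACA.
by rewrite !scalerDr addrACA.
Qed.

Fact cplx_scaleDl p : {morph cplx_scale^~ p : a b / a + b}.
Proof.
case: p => x y [a1 a2] [b1 b2]; rewrite /cplx_scale /=; congr (_, _) => /=.
  by rewrite !scalerDl opprD addrACA.
by rewrite !scalerDl addrACA.
Qed.

HB.instance Definition _ := GRing.Zmodule_isLmodule.Build R[i] (cplx V)
  cplx_scaleA cplx_scale1 cplx_scaleDr cplx_scaleDl.

Definition cplx_in (x : V) : cplx V := (x, 0).

Definition cplx_set (A : set V) : set (cplx V) := [set p | A p.1 /\ A p.2].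

Definition cplx_br (br : V -> V -> V) (p q : cplx V) : cplx V :=
  (br p.1 q.1 - br p.2 q.2, br p.1 q.2 + br p.2 q.1).

End Complexification.

(* A germ at 0 of a holomorphic function of N variables is given by its power
   series, i.e. by the family of its coefficients indexed by multi-indices;
   the space [fps] contains all formal series, and [ps_converges] selects the
   germs. *)

Definition mindex (N : nat) := {ffun 'I_N -> nat}.

Definition mdegree N (m : mindex N) : nat := (\sum_i m i)%N.

Definition fps (R : realType) (N : nat) := mindex N -> R[i].

Definition box_index N d (l : {ffun 'I_N -> 'I_d}) : mindex N :=
  [ffun i => l i : nat].

Section PowerSeries.
Variables (R : realType) (N : nat).
Implicit Types (a b : fps R N) (m : mindex N).

Definition ps_mul a b : fps R N := fun m =>
  \sum_(l : {ffun 'I_N -> 'I_(mdegree m).+1} | [forall i, (l i <= m i)%N])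
    a (box_index l) * b [ffun i => (m i - l i)%N].

Definition ps_deriv (i : 'I_N) a : fps R N := fun m =>
  (m i).+1%:R * a [ffun j => (m j + (j == i))%N].

(* Absolute convergence on some closed polydisc centred at 0. *)
Definition ps_converges a :=
  exists r M : R, 0 < r /\ forall d : nat,
    \sum_(l : {ffun 'I_N -> 'I_d})
       `|a (box_index l)| * r%:C ^+ mdegree (box_index l) <= M%:C.

(* Meaningful where the series converges absolutely. *)
Definition ps_eval a (x : 'rV[R[i]]_N) : R[i] :=
  limn (fun d => (\sum_(l : {ffun 'I_N -> 'I_d})
                    a (box_index l) * \prod_i x 0 i ^+ l i) : R[i]^o).

End PowerSeries.

(* [X i] is the coefficient of the i-th coordinate field. *)
Definition vfield (R : realType) (N : nat) : Type := 'I_N -> fps R N.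

(* [vfield] is taken as a vector space over the reals; [Rcomplex R] is R[i]
   with its R-module structure. *)
HB.instance Definition _ (R : realType) (N : nat) :=
  GRing.Lmodule.copy (vfield R N) ('I_N -> mindex N -> Rcomplex R).

Definition vf_bracket (R : realType) N (X Y : vfield R N) : vfield R N :=
  fun i m => \sum_j (ps_mul (X j) (ps_deriv j (Y i)) m
                     - ps_mul (Y j) (ps_deriv j (X i)) m).

Arguments vf_bracket {R N}.

Definition vf_eval (R : realType) N (X : vfield R N) (x : 'rV[R[i]]_N)
  : 'rV[R[i]]_N := \row_i ps_eval (X i) x.

(* The d-jet at 0 vanishes. *)
Definition jet_vanishes (R : realType) N (d : int) (X : vfield R N) :=
  forall i m, (mdegree m)%:Z <= d -> X i m = 0.

Definition at_least_jet_determined (R : realType) N (K : int)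
  (X : vfield R N) := jet_vanishes (K - 1) X.

Section Quadric.
Variables (R : realType) (n k : nat) (H : 'I_k -> 'M[R[i]]_n).
Local Notation C := R[i].

Definition conjtr (m p : nat) (A : 'M[C]_(m, p)) : 'M[C]_(p, m) :=
  (map_mx conjc A)^T.

Definition hermitian_form (j : 'I_k) (z : 'rV[C]_n) : C :=
  (z *m H j *m conjtr z) 0 0.

(* A point of C^(n + k) is (z, w) with z = lsubmx p, w = rsubmx p. *)
Definition quadric : set 'rV[C]_(n + k) :=
  [set p | forall j,
     (complex.Im (rsubmx p 0 j))%:C = hermitian_form j (lsubmx p)].

Definition nondegenerate_model :=
  (forall c : 'I_k -> R, \sum_j (c j)%:C *: H j = 0 -> forall j, c j = 0) /\
  (forall z : 'rV[C]_n, (forall j, z *m H j = 0) -> z = 0).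

(* The forms are real-valued for Hermitian [H j], so these k real functions
   define the quadric. *)
Definition defining_fun (j : 'I_k) (p : 'rV[C]_(n + k)) : R :=
  complex.Im (rsubmx p 0 j) - complex.Re (hermitian_form j (lsubmx p)).

Definition tangent_vector (p v : 'rV[C]_(n + k)) :=
  forall j, is_derive (0 : R) (1 : R)
    (fun t : R => defining_fun j (p + t%:C *: v)) (0 : R).

(* The real part of a holomorphic field X is, at p, a real multiple of the
   vector X(p) of C^(n + k) seen as a real vector space. *)
Definition aut_germs : set (vfield R (n + k)) :=
  [set X | (forall i, ps_converges (X i)) /\
     exists eps : R, 0 < eps /\ forall p, quadric p ->
       (forall i, `|p 0 i| < eps%:C) -> tangent_vector p (vf_eval X p)].

End Quadric.

Section Grading.
Variables (R : realType) (n k : nat).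
Local Notation vf := (vfield R (n + k)).
Implicit Types (A : set vf) (X Y : vf).

Definition wt (i : 'I_(n + k)) : nat :=
  match fintype.split i with inl _ => 1 | inr _ => 2 end.

Definition euler : vf := fun i m =>
  if m == [ffun j => (j == i) : nat] then (wt i)%:R else 0.

Definition gr A (b : int) : set vf :=
  eigensp vf_bracket A euler b%:~R.

(* A = A_lo + ... + A_hi; directness is automatic for eigenspaces. *)
Definition graded A (lo hi : int) :=
  lo <= hi /\ forall X, A X -> exists2 Y : int -> vf,
    (forall b, gr A b (Y b)) & X = \sum_(i < `|hi - lo|%N.+1) Y (lo + i%:Z).

(* [b] is the weighted degree of all monomials of X. *)
Definition weighted_homogeneous (b : R) X :=
  forall i m, X i m <> 0 -> (\sum_j m j * wt j)%N%:R - (wt i)%:R = b.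

(* Y = J X in g_{-1}: the degree -1 part of the algebra [g] is identified with
   C^n by taking the values at 0 of the z-components. *)
Definition is_J (g : set vf) X Y :=
  [/\ gr g (-1) X, gr g (-1) Y &
      forall j : 'I_n, Y (lshift k j) 0 = 'i * X (lshift k j) 0].

Definition J_stable (g A : set vf) :=
  forall X Y, gr A (-1) X -> is_J g X Y -> gr A (-1) Y.

Definition compatible_with_grading (g s Rad : set vf) :=
  [/\ forall X, s X -> s (vf_bracket euler X),
      graded s (-2) 2,
      exists b : int, graded Rad (-2) b,
      J_stable g s & J_stable g Rad].

Definition grading_element (s : set vf) (Es : vf) :=
  s Es /\ forall (j : int) X, gr s j X -> vf_bracket Es X = j%:~R *: X.

End Grading.

Arguments euler {R n k}.

(* Main.v *)
(* On W put T = ad Es - ad E. Both Es and E induce the grading of s, so T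
   commutes with s. On a complex eigenspace U of T with eigenvalue mu, the trace
   of Es vanishes because s is perfect, whence mu dim U = - tr_U E; as E has
   integer eigenvalues, mu is real, and irreducibility over the reals makes T
   equal to mu on W. Thus the eigenvalues of Es on W are those of E shifted by
   mu. A highest weight vector is killed by s_1 and s_2, so its real and
   imaginary parts generate W under the part of s of nonpositive degree:
   its degree is the largest one, c. Symmetrically a lowest weight vector has
   degree -2. *)
Require Import Defs.
From HB Require Import structures.
From mathcomp Require Import all_boot all_order all_algebra.
From mathcomp Require Import all_classical all_reals all_analysis.
From mathcomp Require Import complex ring zify ssrAC.
Import Order.TTheory GRing.Theory Num.Theory.
Import numFieldNormedType.Exports.
Local Open Scope classical_set_scope.
Local Open Scope ring_scope.
Local Open Scope complex_scope.
Set Implicit Arguments.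
Unset Strict Implicit.
Unset Printing Implicit Defensive.
(* The topological [subspace] of MathComp-Analysis shadows the one of Defs. *)
Local Notation subspace := Defs.subspace.

(** * Linear algebra on predicates *)

(** The obstacle is that [W] is irreducible over the reals only: Schur's lemma places T in a
    division algebra that may contain nonreal scalars, so irreducibility alone cannot exclude a
    nonreal mu. The trace does. It needs E to act on U although E need not lie in [s]; this holds
    because [Es, E] = -[Es, Es] = 0, so that E commutes with T.

    Traces need finite dimension, which is read off the grading: a bound on the weighted degree
    leaves finitely many monomials.

    The unknown shift cancels in Kmax - Kmin, which is therefore c + 2. The halving in the jet order
    comes from the weight 2 of the w-variables: a monomial of degree d has weighted degree at most
    2d. *)

Section Subspaces.
Variables (K : fieldType) (V : lmodType K).
Implicit Types (A B : set V) (f : V -> V).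

Section Closure.
Variables (A : set V) (sA : subspace A).

Lemma subspace0 : A 0. Proof. exact: sA.1. Qed.

Lemma subspaceZ a x : A x -> A (a *: x).
Proof.
by move=> Ax; rewrite -[_ *: _]addr0; apply: sA.2 => //; exact: sA.1.
Qed.

Lemma subspaceD x y : A x -> A y -> A (x + y).
Proof. by move=> Ax Ay; rewrite -[x]scale1r; exact: sA.2. Qed.

Lemma subspaceN x : A x -> A (- x).
Proof. by rewrite -scaleN1r; exact: subspaceZ. Qed.

Lemma subspace_sum (I : Type) (r : seq I) (P : pred I) (F : I -> V) :
  (forall i, P i -> A (F i)) -> A (\sum_(i <- r | P i) F i).
Proof.
by move=> AF; apply: big_ind => //; [exact: subspace0|exact: subspaceD].
Qed.

End Closure.

Lemma nonzero_of_neq0 A : subspace A -> A <> [set 0] -> exists2 x, A x & x <> 0.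
Proof.
move=> sA nA; apply: contrapT => no; apply: nA; apply/seteqP; split => x.
  by move=> Ax; apply: contrapT => x0; apply: no; exists x.
by move=> ->; exact: subspace0.
Qed.

Lemma linear_fun0 f : linear f -> f 0 = 0.
Proof.
by move=> lf; have := lf (-1) 0 0; rewrite scaler0 add0r scaleN1r addNr.
Qed.

Lemma linear_funZ f a x : linear f -> f (a *: x) = a *: f x.
Proof. by move=> lf; have := lf a x 0; rewrite (linear_fun0 lf) !addr0. Qed.

Lemma linear_funD f x y : linear f -> f (x + y) = f x + f y.
Proof. by move=> lf; have := lf 1 x y; rewrite !scale1r. Qed.

Lemma linear_fun_sum f (I : Type) (r : seq I) (P : pred I) (F : I -> V) :
  linear f -> f (\sum_(i <- r | P i) F i) = \sum_(i <- r | P i) f (F i).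
Proof.
move=> lf; apply: (big_morph f) => [x y|]; first exact: linear_funD.
exact: linear_fun0.
Qed.

(* Independence of eigenvectors is the case A = 0. *)
Lemma eigen_components f A (I : eqType) (r : seq I) (nu : I -> K) (w : I -> V) :
  linear f -> subspace A -> (forall x, A x -> A (f x)) -> uniq (map nu r) ->
  (forall i, f (w i) = nu i *: w i) -> A (\sum_(i <- r) w i) ->
  forall i, i \in r -> A (w i).
Proof.
move=> lf sA fA; elim: r w => [//|i0 r IH] w /= /andP[nu0r ur] fw.
rewrite big_cons => Aw.
have Atl i : i \in r -> A (w i).
  move=> ir; have nui0 : nu i - nu i0 != 0.
    by rewrite subr_eq0; apply: contraNneq nu0r => <-; exact: map_f.
  suff : A ((nu i - nu i0) *: w i).
    by move/(subspaceZ sA (nu i - nu i0)^-1); rewrite scalerA mulVf// scale1r.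
  apply: (IH (fun i => (nu i - nu i0) *: w i)) => // [j|].
    by rewrite linear_funZ// fw !scalerA mulrC.
  (* [f - nu i0] kills the [i0] term and multiplies the others by scalars, which leaves a shorter
     sum in [A]. *)
  have := subspaceD sA (fA _ Aw) (subspaceN sA (subspaceZ sA (nu i0) Aw)).
  rewrite linear_funD// linear_fun_sum// fw scalerDr opprD addrACA subrr add0r.
  rewrite scaler_sumr -sumrB; congr A; apply: eq_bigr => j _.
  by rewrite fw -scalerBl.
move=> i; rewrite inE => /orP[/eqP -> |/Atl//].
have As : A (\sum_(j <- r) w j).
  by rewrite big_seq; apply: subspace_sum.
by have := subspaceD sA Aw (subspaceN sA As); rewrite addrK.
Qed.

(** Diagonalizability supplies eigenvectors whose eigenvalues may repeat, while [eigen_components]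
    wants distinct ones: terms with the same eigenvalue are added up. *)
Lemma eigen_grouping f x (m : nat) (mu : 'I_m -> K) (z : 'I_m -> V) :
  linear f -> (forall i, f (z i) = mu i *: z i) -> x = \sum_i z i ->
  exists ns : seq K, exists w : K -> V,
    [/\ uniq ns, forall nu, f (w nu) = nu *: w nu & x = \sum_(nu <- ns) w nu].
Proof.
move=> lf fz ->; exists (undup [seq mu i | i <- enum 'I_m]).
exists (fun nu => \sum_(i | mu i == nu) z i); split.
- exact: undup_uniq.
- move=> nu; rewrite linear_fun_sum// scaler_sumr.
  by apply: eq_bigr => i /eqP <-.
rewrite (exchange_big_dep predT) //=; apply: eq_bigr => i _.
rewrite (big_rem (mu i)) /=; last first.
  by rewrite mem_undup; apply/mapP; exists i => //; rewrite mem_enum.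
rewrite eqxx big1_seq ?addr0// => nu /andP[/eqP <-].
by rewrite mem_rem_uniq ?undup_uniq// inE eqxx.
Qed.

Definition lincomb d (e : 'I_d -> V) (a : 'rV[K]_d) : V := \sum_i a 0 i *: e i.

Definition spanned A d (e : 'I_d -> V) :=
  forall x, A x -> exists a, x = lincomb e a.

(** The vectors [e] may lie outside [A], so that the notion passes to subsets. *)
Definition findim A := exists d (e : 'I_d -> V), spanned A e.

Definition is_basis A d (e : 'I_d -> V) :=
  [/\ forall i, A (e i), forall a, lincomb e a = 0 -> a = 0 & spanned A e].

Lemma lincomb_linear d (e : 'I_d -> V) c a b :
  lincomb e (c *: a + b) = c *: lincomb e a + lincomb e b.
Proof.
rewrite /lincomb scaler_sumr -big_split; apply: eq_bigr => i _.
by rewrite !mxE scalerDl scalerA.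
Qed.

Lemma lincomb0 d (e : 'I_d -> V) : lincomb e 0 = 0.
Proof. by rewrite /lincomb big1// => i _; rewrite mxE scale0r. Qed.

Lemma lincomb_mul d d' (e : 'I_d -> V) (M : 'M[K]_(d', d)) a :
  lincomb e (a *m M) = \sum_i a 0 i *: lincomb e (row i M).
Proof.
rewrite /lincomb; under [in RHS]eq_bigr do rewrite scaler_sumr.
rewrite exchange_big; apply: eq_bigr => j _; rewrite mxE scaler_suml.
by apply: eq_bigr => i _; rewrite mxE scalerA.
Qed.

Lemma lincomb_in A d (e : 'I_d -> V) a :
  subspace A -> (forall i, A (e i)) -> A (lincomb e a).
Proof. by move=> sA Ae; apply: subspace_sum => // i _; exact: subspaceZ. Qed.

(** A free family of maximal size is a basis; the size of a spanning family bounds that of the free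
    ones. *)
Lemma findim_basis A : subspace A -> findim A ->
  exists d (e : 'I_d -> V), is_basis A e.
Proof.
move=> sA [d [e eA]].
pose free m := exists f : 'I_m -> V,
  (forall i, A (f i)) /\ forall a, lincomb f a = 0 -> a = 0.
have free0 : exists m, `[< free m >].
  exists 0%N; apply/asboolP; exists (fun=> 0); split=> [i|a _].
    exact: subspace0.
  by apply/rowP => -[].
have bound m : `[< free m >] -> (m <= d)%N.
  move=> /asboolP[f [Af ff]]; rewrite leqNgt; apply/negP => lt_dm.
  have /choice[M fM] i : exists a, f i = lincomb e a by exact: eA.
  pose N := \matrix_i M i.
  (* The [m] rows of [N] live in dimension [d < m]; a left kernel vector of [N] is a nontrivial
     relation among the [f i]. *)
  have /negP[] : ~~ row_free N.
    by rewrite -row_leq_rank -ltnNge (leq_ltn_trans (rank_leq_col _)).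
  apply/row_freeP; apply: contrapT => nN.
  have : kermx N != 0.
    apply/eqP => k0; apply: nN; apply/row_freeP.
    by rewrite -kermx_eq0 k0.
  case/rowV0Pn => u /sub_kermxP uN /eqP; case; apply: ff.
  rewrite -(lincomb0 e) -uN lincomb_mul; apply: eq_bigr => i _.
  by rewrite rowK -fM.
case: (ex_maxnP free0 bound) => m /asboolP[f [Af ff]] m_max.
exists m, f; split=> // x Ax.
(* Adding [x] in front breaks freeness by maximality; since [f] is free, [x] has a nonzero
   coefficient in the relation and can be solved for. *)
pose f' (i : 'I_m.+1) := oapp f x (unlift ord0 i).
have : ~ free m.+1 by move=> /asboolP /m_max; rewrite ltnn.
move=> nf; have {nf} : exists a, lincomb f' a = 0 /\ a <> 0.
  apply: contrapT => no; apply: nf; exists f'; split.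
    by move=> i; rewrite /f'; case: unliftP => [j|] _ /=.
  by move=> a a0; apply: contrapT => na; apply: no; exists a.
case=> a []; rewrite [lincomb f' a]/lincomb big_ord_recl /f' unlift_none /=.
under eq_bigr do rewrite liftK /=.
pose b := \row_i a 0 (lift ord0 i).
have -> : \sum_(i < m) a 0 (lift ord0 i) *: f i = lincomb f b.
  by apply: eq_bigr => i _; rewrite mxE.
case: (eqVneq (a 0 ord0) 0) => [a0|a0 e0 _].
  rewrite a0 scale0r add0r => /ff b0; case; apply/rowP => i; rewrite mxE.
  case: (unliftP ord0 i) => [j ->|-> //].
  by have := congr1 (fun r : 'rV_m => r 0 j) b0; rewrite !mxE.
exists ((- (a 0 ord0)^-1) *: b + 0).
rewrite lincomb_linear lincomb0 addr0 scaleNr.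
move/eqP: e0; rewrite addr_eq0 => /eqP/(congr1 (fun y => (a 0 ord0)^-1 *: y)).
by rewrite scalerA mulVf// scale1r scalerN.
Qed.

Lemma findim_sub A B : A `<=` B -> findim B -> findim A.
Proof. by move=> AB [d [e eB]]; exists d, e => x /AB /eB. Qed.

Lemma findim_finType A (I : finType) (e : I -> V) :
  (forall x, A x -> exists a : I -> K, x = \sum_i a i *: e i) -> findim A.
Proof.
move=> eA; exists #|I|, (fun i => e (enum_val i)) => x /eA[a ->].
exists (\row_i a (enum_val i)).
rewrite (reindex _ (onW_bij _ (enum_val_bij I))).
by apply: eq_bigr => i _; rewrite mxE.
Qed.

(** * Matrices of endomorphisms in a basis *)

Section MatrixOf.
Variables (A : set V) (d : nat) (e : 'I_d -> V).
Hypotheses (sA : subspace A) (eA : is_basis A e).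

Definition coord x : 'rV[K]_d := xget 0 [set a | x = lincomb e a].

Lemma coordK x : A x -> lincomb e (coord x) = x.
Proof.
case: eA => _ _ sp /sp[a xa]; rewrite /coord; case: xgetP => [b _ /= ->//|].
by move=> /(_ a).
Qed.

Lemma lincomb_inj : injective (lincomb e).
Proof.
move=> a b ab; case: eA => _ fr _; apply/eqP; rewrite -subr_eq0; apply/eqP/fr.
by rewrite addrC -scaleN1r lincomb_linear ab scaleN1r addNr.
Qed.

(** Coordinates are row vectors, so matrices act on the right and composition reverses the
    factors. *)
Definition mx_of f : 'M[K]_d := \matrix_i coord (f (e i)).

Definition stable_linear f := linear f /\ forall x, A x -> A (f x).

Lemma mx_ofP f a : stable_linear f ->
  f (lincomb e a) = lincomb e (a *m mx_of f).
Proof.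
move=> [lf fA]; rewrite lincomb_mul /lincomb linear_fun_sum//.
apply: eq_bigr => i _; rewrite linear_funZ// rowK; congr (_ *: _).
by apply/esym/coordK/fA; case: eA.
Qed.

Lemma eq_mx_of f (M : 'M[K]_d) :
  (forall a, f (lincomb e a) = lincomb e (a *m M)) -> mx_of f = M.
Proof.
move=> fM; apply/row_matrixP => i; rewrite rowK; apply: lincomb_inj.
have ei : e i = lincomb e (delta_mx 0 i).
  rewrite /lincomb (bigD1 i)//= mxE !eqxx scale1r big1 ?addr0// => j ji.
  by rewrite mxE (negPf ji) andbF scale0r.
by rewrite rowE -fM -ei coordK// ei fM; apply: lincomb_in => //; case: eA.
Qed.

Lemma mx_of_comp f g : stable_linear f -> stable_linear g ->
  mx_of (fun x => f (g x)) = mx_of g *m mx_of f.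
Proof.
move=> sf sg; apply: eq_mx_of => a.
by rewrite (mx_ofP _ sg) (mx_ofP _ sf) mulmxA.
Qed.

Lemma mx_of_linear c f g : stable_linear f -> stable_linear g ->
  mx_of (fun x => c *: f x + g x) = c *: mx_of f + mx_of g.
Proof.
move=> sf sg; apply: eq_mx_of => a.
rewrite (mx_ofP _ sf) (mx_ofP _ sg) -lincomb_linear.
by rewrite mulmxDr -scalemxAr.
Qed.

Lemma mx_of_scale c : mx_of (fun x => c *: x) = c%:M.
Proof.
apply: eq_mx_of => a; rewrite mul_mx_scalar -[in RHS](addr0 (c *: a)).
by rewrite lincomb_linear lincomb0 addr0.
Qed.

Lemma mx_of_ext f g : (forall x, A x -> f x = g x) -> mx_of f = mx_of g.
Proof.
by move=> fg; apply/row_matrixP => i; rewrite !rowK fg//; case: eA.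
Qed.

Lemma eigenvalue_mx_of f c : stable_linear f -> eigenvalue (mx_of f) c ->
  exists x, [/\ A x, x <> 0 & f x = c *: x].
Proof.
move=> sf /eigenvalueP[a ac a0]; exists (lincomb e a); split.
- by apply: lincomb_in => //; case: eA.
- by case: eA => _ fr _ /fr /eqP; rewrite (negPf a0).
rewrite mx_ofP// ac -[in LHS](addr0 (c *: a)).
by rewrite lincomb_linear lincomb0 addr0.
Qed.

Lemma is_basis_dim_gt0 : A <> [set 0] -> (0 < d)%N.
Proof.
move=> nA; rewrite lt0n; apply/eqP => d0; apply: nA; apply/seteqP; split => x.
  case: eA => _ _ sp /sp[a ->]; rewrite /lincomb big1// => i _.
  by exfalso; move: (leq_ltn_trans (leq0n i) (ltn_ord i)); rewrite lt0n d0.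
by move=> ->; exact: subspace0.
Qed.

End MatrixOf.

End Subspaces.

(** The trace is the sum of the roots of the characteristic polynomial, and these roots are
    eigenvalues. It will serve with [P] the set of real numbers. *)
Lemma trace_of_eigenvalues (K : closedFieldType) (d : nat) (M : 'M[K]_d)
    (P : set K) :
  P 0 -> (forall x y, P x -> P y -> P (x + y)) ->
  (forall c, eigenvalue M c -> P c) -> P (\tr M).
Proof.
case: d M => [|d] M P0 PD eP; first by rewrite /mxtrace big_ord0.
have [r Mr] := closed_field_poly_normal (char_poly M).
move: Mr; rewrite (monicP (char_poly_monic M)) scale1r => Mr.
have szr : size r = d.+1.
  by apply: succn_inj; rewrite -(size_prod_XsubC r id) -Mr size_char_poly.
have -> : \tr M = \sum_(c <- r) c.
  apply: oppr_inj; rewrite -char_poly_trace// Mr /=.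
  by rewrite -[d]/(d.+1.-1) -szr coefPn_prod_XsubC// szr.
have : {subset r <= eigenvalue M}.
  by move=> c; rewrite -[c \in r]root_prod_XsubC -Mr -eigenvalue_root_char.
move=> sr; rewrite big_seq; apply: big_ind => // c /sr; exact: eP.
Qed.

Lemma closed_eigenvalue (K : closedFieldType) (d : nat) (M : 'M[K]_d) :
  (0 < d)%N -> exists c, eigenvalue M c.
Proof.
move=> d0; have [|c] := @closed_rootP _ (char_poly M) _.
  by rewrite size_char_poly; case: d d0 M.
by rewrite -eigenvalue_root_char; exists c.
Qed.

(** * Lie brackets *)

Section LieBrackets.
Variables (K : fieldType) (V : lmodType K) (br : V -> V -> V).
Implicit Types (A L h Z : set V) (x y z u v : V).

Definition lie_bracket :=
  [/\ forall x, linear (br x), forall x y, br x y = - br y x &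
      forall x y z, br x (br y z) = br (br x y) z + br y (br x z)].

Hypothesis brL : lie_bracket.

Lemma br_linr x : linear (br x). Proof. by case: brL. Qed.

Lemma br_anti x y : br x y = - br y x. Proof. by case: brL. Qed.

Lemma br_jacobi x y z : br x (br y z) = br (br x y) z + br y (br x z).
Proof. by case: brL. Qed.

Lemma br_linl z : linear (br^~ z).
Proof.
by move=> a x y; rewrite /= !(br_anti _ z) br_linr opprD scalerN.
Qed.

Lemma br0r x : br x 0 = 0. Proof. exact/linear_fun0/br_linr. Qed.
Lemma br0l x : br 0 x = 0. Proof. exact: (linear_fun0 (br_linl x)). Qed.
Lemma brZr a x y : br x (a *: y) = a *: br x y.
Proof. exact/linear_funZ/br_linr. Qed.
Lemma brZl a x y : br (a *: x) y = a *: br x y.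
Proof. exact: (linear_funZ _ _ (br_linl y)). Qed.
Lemma brDr x y z : br x (y + z) = br x y + br x z.
Proof. exact/linear_funD/br_linr. Qed.
Lemma brDl x y z : br (x + y) z = br x z + br y z.
Proof. exact: (linear_funD _ _ (br_linl z)). Qed.

Lemma br_suml (I : Type) (r : seq I) (Q : pred I) (F : I -> V) z :
  br (\sum_(i <- r | Q i) F i) z = \sum_(i <- r | Q i) br (F i) z.
Proof. exact: (linear_fun_sum _ _ _ (br_linl z)). Qed.

Lemma br_sumr (I : Type) (r : seq I) (Q : pred I) (F : I -> V) z :
  br z (\sum_(i <- r | Q i) F i) = \sum_(i <- r | Q i) br z (F i).
Proof. exact/linear_fun_sum/br_linr. Qed.

Lemma subspace_eigensp A x mu : subspace A -> subspace (eigensp br A x mu).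
Proof.
move=> sA; split; first by split; [exact: subspace0|rewrite br0r scaler0].
move=> a y z [Ay ey] [Az ez]; split; first exact: sA.2.
by rewrite br_linr ey ez scalerDr !scalerA mulrC.
Qed.

(** On a simple ideal [S i], the part lying in [Z] is an ideal because [Z] contains all brackets,
    and it is nonzero because [S i] is not abelian; so it is all of [S i]. *)
Lemma semisimple_perfect L Z : lie_semisimple br L -> subspace Z ->
  (forall x y, L x -> L y -> Z (br x y)) -> L `<=` Z.
Proof.
case=> r [S [SL LS _]] sZ ZL x /LS[y Sy ->]; apply: subspace_sum => // i _.
have [[sSi SiL idS] [nab simpS]] := SL i.
pose I := S i `&` Z.
suff : I = S i by move=> eI; have := Sy i; rewrite -eI => -[].
have idI : lie_ideal br (S i) I.
  split; first by split=> [|a u v [Su Zu] [Sv Zv]]; split;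
    [exact: subspace0|exact: subspace0|exact: sSi.2|exact: sZ.2].
    by move=> u [].
  move=> u v Su [Sv _].
  by split; [exact: idS (SiL _ Su) Sv|exact: ZL (SiL _ Su) (SiL _ Sv)].
case: (simpS I idI) => // I0; case: nab => u [v [Su Sv uv0]]; case: uv0.
have : I (br u v).
  by split; [exact: idS (SiL _ Su) Sv|exact: ZL (SiL _ Su) (SiL _ Sv)].
by rewrite I0.
Qed.

(** * Joint eigenvectors of a toral subalgebra *)

Section Toral.
Variables (L h : set V) (u : V).
Hypotheses (sL : subspace L) (LL : forall x y, L x -> L y -> L (br x y)).
Hypotheses (th : toral br L h) (fh : findim h) (hu : h u).

(* Simultaneous diagonalisation, in the form of an induction principle. *)
Lemma toral_joint_eigen (j : K) Z : subspace Z ->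
  (forall x, L x -> (forall t, h t -> exists a, br t x = a *: x) ->
     br u x = j *: x -> Z x) ->
  forall x, L x -> br u x = j *: x -> Z x.
Proof.
move=> sZ Zjoint; have [sh hL hab hdiag] := th.
have [d [e [he _ spe]]] := findim_basis sh fh.
(* [x] is already an eigenvector of the first [m] basis vectors of [h]; the other [r] remain to be
   treated. *)
suff main r m : (m + r)%N = d -> forall x, L x -> br u x = j *: x ->
    (forall i : 'I_d, (i < m)%N -> exists a, br (e i) x = a *: x) -> Z x.
  by move=> x Lx ux; apply: (main d 0%N).
elim: r m => [|r IH] m mrd x Lx ux ex.
  apply: Zjoint => // t /spe[a ->].
  have /choice[b eb] (i : 'I_d) : exists c, br (e i) x = c *: x.
    by apply: ex; rewrite -(addn0 m) mrd.
  exists (\sum_i a 0 i * b i); rewrite br_suml scaler_suml.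
  by apply: eq_bigr => i _; rewrite brZl eb scalerA.
have lt_md : (m < d)%N by rewrite -mrd addnS ltnS leq_addr.
pose t := e (Ordinal lt_md); have ht : h t by exact: he.
have /choice[b eb] (i : 'I_d) :
    exists c, (i < m)%N -> br (e i) x = c *: x.
  have [lt_im|ge_im] := ltnP i m; last by exists 0.
  by have [c ec] := ex _ lt_im; exists c.
(* Since [h] is abelian, [t] preserves this space of vectors with the same eigenvalues as [x], so
   the components of [x] along the eigenspaces of [t] stay in it. *)
pose A := [set y | [/\ L y, br u y = j *: y &
                   forall i : 'I_d, (i < m)%N -> br (e i) y = b i *: y]].
have commA s c y : h s -> br s y = c *: y -> br s (br t y) = c *: br t y.
  by move=> hs sy; rewrite br_jacobi (hab _ _ hs ht) br0l add0r sy brZr.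
have [p [mu [z [ez xz]]]] := hdiag t ht x Lx.
have [ns [w [uns ew xw]]] :=
  eigen_grouping (br_linr t) (fun i => (ez i).2) xz.
have Aw : forall nu, nu \in ns -> A (w nu).
  apply: (eigen_components (nu := id) (br_linr t)) => //.
  - split; first split=> [||i _].
    + exact: subspace0.
    + by rewrite br0r scaler0.
    + by rewrite br0r scaler0.
    move=> a y z' [Ly uy ey] [Lz' uz' ez']; split=> [||i im].
    + exact: sL.2.
    + by rewrite br_linr uy uz' scalerDr !scalerA mulrC.
    + by rewrite br_linr ey// ez'// scalerDr !scalerA mulrC.
  - move=> y [Ly uy ey]; split=> [||i im].
    + by apply: LL => //; exact/hL.
    + exact: commA.
    + by apply: commA; [exact: he|exact: ey].
  - by rewrite map_id.
  - by rewrite -xw.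
rewrite xw big_seq; apply: subspace_sum => // nu nu_ns.
have [Lw uw ewi] := Aw _ nu_ns.
apply: (IH m.+1) => //; first by rewrite addSnnS.
move=> i; rewrite ltnS leq_eqVlt => /orP[/eqP im|/ewi ei]; last by exists (b i).
by exists nu; rewrite -(ew nu); congr br; congr e; exact: val_inj.
Qed.

(** This passes from root spaces to a whole eigenspace of [u]. The elements killing [v] form a
    subspace, so [x] may be taken to be a joint eigenvector of [h]; its eigenvalues then define a
    root, nonzero because its value at [u] is [j]. *)
Lemma root_vectors_kill (P : set (V -> K)) v (j : K) : j != 0 ->
  (forall alpha, roots_of br L h alpha -> alpha u = j -> P alpha) ->
  (forall alpha x, P alpha -> root_space br L h alpha x -> br x v = 0) ->
  forall x, L x -> br u x = j *: x -> br x v = 0.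
Proof.
move=> j0 Pj Pv; apply: (toral_joint_eigen (Z := [set x | br x v = 0])).
  split=> [|a x y xv yv]; first exact: br0l.
  by rewrite /= (br_linl v) xv yv scaler0 addr0.
move=> x Lx ex ux; case: (eqVneq x 0) => [->|x0]; first exact: br0l.
have scale_inj a b : a *: x = b *: x -> a = b.
  move/eqP; rewrite -subr_eq0 -scalerBl scaler_eq0 (negPf x0) orbF subr_eq0.
  by move/eqP.
(* The value 0 off [h] is the one that [functional_on] demands. *)
have /choice[al eal] t : exists c, (h t -> br t x = c *: x) /\ (~ h t -> c = 0).
  by have [/[dup] ht /ex[c ec]|nt] := pselect (h t); [exists c|exists 0]; split.
have alu : al u = j by apply: scale_inj; rewrite -(eal u).1.
have sh : subspace h by case: th.
have root_x : root_space br L h al x by split=> // t /(eal t).1.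
apply: (Pv al) => //; apply: Pj => //; split.
- split=> [a s t hs ht|t /(eal t).2//]; apply: scale_inj.
  rewrite -(eal _).1; last exact: sh.2.
  by rewrite (br_linl x) (eal s).1// (eal t).1// scalerDl scalerA.
- by move=> al0; case/eqP: j0; rewrite -alu al0.
- by move=> R0; case/eqP: x0; move: root_x; rewrite R0.
Qed.

End Toral.

End LieBrackets.

(** * Complexification of a Lie bracket *)

Section ComplexifiedBracket.
Variables (R : realType) (V : lmodType R) (br : V -> V -> V).
Hypothesis brL : lie_bracket br.

Lemma cplx_scaleE (a : R[i]) (p : cplx V) :
  a *: p = (complex.Re a *: p.1 - complex.Im a *: p.2,
            complex.Re a *: p.2 + complex.Im a *: p.1) :> cplx V.
Proof. by []. Qed.

Lemma cplx_scale_real (a : R) (p : cplx V) :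
  a%:C *: p = (a *: p.1, a *: p.2) :> cplx V.
Proof. by rewrite cplx_scaleE /= !scale0r subr0 addr0. Qed.

Lemma cplx_br_in x (p : cplx V) :
  cplx_br br (cplx_in x) p = (br x p.1, br x p.2).
Proof. by rewrite /cplx_br /= !(br0l brL) subr0 addr0. Qed.

Lemma cplx_lie_bracket : lie_bracket (cplx_br br).
Proof.
have D := (brDr brL, brDl brL); have Z := (brZr brL, brZl brL).
have N x y : br x (- y) = - br x y by rewrite -scaleN1r Z scaleN1r.
have N' x y : br (- x) y = - br x y by rewrite -scaleN1r Z scaleN1r.
split.
- move=> [x1 x2] a [y1 y2] [z1 z2]; rewrite cplx_scaleE.
  rewrite /cplx_br /= !(D, N, N', Z); congr (_, _) => /=;
    rewrite !scalerBr !scalerDr ?scalerN ?opprD !addrA;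
    by rewrite [LHS](ACl (1*4*2*5*3*6)).
- move=> [x1 x2] [y1 y2]; rewrite /cplx_br /=; congr (_, _) => /=.
    by rewrite opprB (br_anti brL x1) (br_anti brL x2) opprK addrC.
  by rewrite (br_anti brL x1) (br_anti brL x2) opprD addrC.
- move=> [x1 x2] [y1 y2] [z1 z2]; rewrite /cplx_br /= !(D, N, N').
  congr (_, _) => /=; rewrite !(br_jacobi brL x1) !(br_jacobi brL x2);
    rewrite ?opprD !addrA; by rewrite [LHS](ACl (1*7*3*5*2*6*4*8)).
Qed.

Lemma subspace_cplx_set (A : set V) : subspace A -> subspace (cplx_set A).
Proof.
move=> sA; split; first by split; exact: subspace0.
move=> a p q [A1 A2] [B1 B2].
rewrite cplx_scaleE; split; apply: subspaceD => //.
  by apply: subspaceD => //; [|apply: subspaceN => //]; exact: subspaceZ.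
by apply: subspaceD => //; exact: subspaceZ.
Qed.

Lemma cplx_sumE (I : Type) (r : seq I) (F : I -> cplx V) :
  \sum_(i <- r) F i = (\sum_(i <- r) (F i).1, \sum_(i <- r) (F i).2) :> cplx V.
Proof. by elim/big_rec3: _ => // i p q [s t] _ [-> ->]. Qed.

Lemma findim_cplx_set (A : set V) : findim A -> findim (cplx_set A).
Proof.
case=> d [e eA]; exists d, (fun i => cplx_in (e i)).
move=> [x y] [/= /eA[a ->] /eA[b ->]].
exists (\row_i (a 0 i +i* b 0 i)); rewrite /lincomb.
rewrite cplx_sumE; congr (_, _); apply: eq_bigr => i _;
  rewrite mxE cplx_scaleE /=.
  by rewrite scaler0 subr0.
by rewrite scaler0 add0r.
Qed.

End ComplexifiedBracket.

(** * Formal power series and vector fields *)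

Section Multiindices.
Variable N : nat.
Implicit Types (l m p : mindex N) (i j : 'I_N).

Definition mle l m := [forall i, l i <= m i]%N.
Definition madd l m : mindex N := [ffun i => (l i + m i)%N].
Definition msub m l : mindex N := [ffun i => (m i - l i)%N].
Definition munit i : mindex N := [ffun j => (j == i) : nat].

(** The sum in [ps_mul] ranges over a finite type that depends on [m]. Listing its indices as plain
    multi-indices lets sums for different [m] be compared by permutations. *)
Definition below m : seq (mindex N) :=
  map (@box_index N _)
    (seq.filter (fun f : {ffun 'I_N -> 'I_(mdegree m).+1} =>
               [forall i, f i <= m i]%N) (enum predT)).

Lemma mleP l m : reflect (forall i, l i <= m i)%N (mle l m).
Proof. exact: forallP. Qed.

Lemma leq_mdegree m i : (m i <= mdegree m)%N.
Proof. by rewrite /mdegree (bigD1 i) //= leq_addr. Qed.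

Lemma box_index_inj d : injective (@box_index N d).
Proof.
move=> l l' e; apply/ffunP => i; apply/val_inj.
by have := congr1 (fun f : mindex N => f i) e; rewrite !ffunE.
Qed.

Lemma below_uniq m : uniq (below m).
Proof.
rewrite map_inj_uniq; first exact/filter_uniq/enum_uniq.
exact: box_index_inj.
Qed.

Lemma mem_below l m : (l \in below m) = mle l m.
Proof.
apply/mapP/mleP => [[f]|le_lm].
  by rewrite mem_filter => /andP[/forallP le_fm _] -> i; rewrite ffunE.
have lt_l i : (l i < (mdegree m).+1)%N.
  by rewrite ltnS (leq_trans (le_lm i)) ?leq_mdegree.
exists [ffun i => Ordinal (lt_l i)].
  rewrite mem_filter mem_enum andbT; apply/forallP => i.
  by rewrite ffunE /= le_lm.
by apply/ffunP => i; rewrite !ffunE.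
Qed.

Lemma msubKC l m : mle l m -> madd l (msub m l) = m.
Proof. by move/mleP => le_lm; apply/ffunP => i; rewrite !ffunE subnKC. Qed.

Lemma maddK l m : msub (madd l m) l = m.
Proof. by apply/ffunP => i; rewrite !ffunE addKn. Qed.

Lemma maddC l m : madd l m = madd m l.
Proof. by apply/ffunP => i; rewrite !ffunE addnC. Qed.

Lemma maddA l m p : madd l (madd m p) = madd (madd l m) p.
Proof. by apply/ffunP => i; rewrite !ffunE addnA. Qed.

Lemma msubK l m : mle l m -> msub m (msub m l) = l.
Proof. by move/mleP => le_lm; apply/ffunP => i; rewrite !ffunE subKn. Qed.

Lemma msub_subr m l p : msub m (madd l p) = msub (msub m l) p.
Proof. by apply/ffunP => i; rewrite !ffunE subnDA. Qed.

Lemma mle_sub l m : mle (msub m l) m.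
Proof. by apply/mleP => i; rewrite ffunE leq_subr. Qed.

Lemma mle_addr l m : mle l (madd l m).
Proof. by apply/mleP => i; rewrite ffunE leq_addr. Qed.

Lemma mle_munit m i : mle (munit i) m = (0 < m i)%N.
Proof.
apply/mleP/idP => [/(_ i)|m_gt0 j]; first by rewrite ffunE eqxx.
by rewrite ffunE; case: eqP => [->|].
Qed.

Lemma madd_inj l : injective (madd l).
Proof. by move=> m p e; rewrite -(maddK l m) e maddK. Qed.

Lemma perm_below_sub m : perm_eq (below m) [seq msub m l | l <- below m].
Proof.
apply: uniq_perm; rewrite ?below_uniq//.
  rewrite map_inj_in_uniq ?below_uniq// => l p.
  by rewrite !mem_below => /msubK {2}<- /msubK {2}<- ->.
move=> l; rewrite mem_below; apply/idP/mapP => [le_lm|[p _ ->]].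
  by exists (msub m l); rewrite ?mem_below ?mle_sub ?msubK.
exact: mle_sub.
Qed.

Lemma perm_below_add l m : mle l m ->
  perm_eq [seq p <- below m | mle l p] [seq madd l q | q <- below (msub m l)].
Proof.
move=> le_lm; apply: uniq_perm; rewrite ?filter_uniq ?below_uniq//.
  by rewrite map_inj_uniq ?below_uniq //; exact: madd_inj.
move=> p; rewrite mem_filter mem_below; apply/andP/mapP => [[le_lp le_pm]|[q]].
  exists (msub p l); rewrite ?msubKC// mem_below.
  by apply/mleP => i; rewrite !ffunE leq_sub2r// (mleP _ _ le_pm).
rewrite mem_below => le_q ->; split; first exact: mle_addr.
apply/mleP => i; rewrite ffunE -leq_subRL; last exact: (mleP _ _ le_lm).
by have := mleP _ _ le_q i; rewrite ffunE.
Qed.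

End Multiindices.

(** * Products and partial derivatives of formal power series *)

Section PowerSeriesRing.
Variables (R : realType) (N : nat).
Implicit Types (a b c : fps R N) (m l : mindex N) (i j : 'I_N).

Lemma ps_mulE a b m : ps_mul a b m = \sum_(l <- below m) a l * b (msub m l).
Proof.
rewrite /below big_map big_filter big_enum_cond /=.
by apply: eq_big => // l _; congr (_ * b _); apply/ffunP => i; rewrite !ffunE.
Qed.

Lemma ps_mulC a b : ps_mul a b = ps_mul b a.
Proof.
apply/funext => m; rewrite !ps_mulE (perm_big _ (perm_below_sub m)) big_map.
rewrite big_seq [RHS]big_seq; apply: eq_bigr => l.
by rewrite mem_below => /msubK ->; exact: mulrC.
Qed.

Lemma ps_mulA a b c : ps_mul a (ps_mul b c) = ps_mul (ps_mul a b) c.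
Proof.
apply/funext => m; rewrite !ps_mulE.
(* Both sides are sums over chains l <= p <= m, where p is the exponent contributed by [a] and [b]
   together. *)
transitivity (\sum_(l <- below m) \sum_(p <- below m | mle l p)
    a l * b (msub p l) * c (msub m p)).
  rewrite big_seq [RHS]big_seq; apply: eq_bigr => l; rewrite mem_below => le_lm.
  rewrite ps_mulE mulr_sumr -[RHS]big_filter.
  rewrite (perm_big _ (perm_below_add le_lm)) [RHS]big_map.
  by apply: eq_bigr => q _; rewrite maddK msub_subr mulrA.
rewrite (exchange_big_dep predT) //= big_seq [RHS]big_seq.
apply: eq_bigr => p; rewrite mem_below => le_pm; rewrite ps_mulE mulr_suml.
rewrite -big_filter; apply: perm_big; apply: uniq_perm.
- exact/filter_uniq/below_uniq.
- exact: below_uniq.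
move=> l; rewrite mem_filter !mem_below; apply/andb_idr => le_lp.
by apply/mleP => i; rewrite (leq_trans (mleP _ _ le_lp i)) ?(mleP _ _ le_pm).
Qed.

Lemma ps_mulDl a b c : ps_mul (a + b) c = ps_mul a c + ps_mul b c.
Proof.
apply/funext => m; rewrite -[RHS]/(ps_mul a c m + ps_mul b c m).
rewrite !ps_mulE -big_split.
by apply: eq_bigr => l _; exact: mulrDl.
Qed.

Lemma ps_mulDr a b c : ps_mul a (b + c) = ps_mul a b + ps_mul a c.
Proof. by rewrite ps_mulC ps_mulDl !(ps_mulC a). Qed.

Lemma ps_mulNl a b : ps_mul (- a) b = - ps_mul a b.
Proof.
apply/funext => m; rewrite -[RHS]/(- ps_mul a b m) !ps_mulE -sumrN.
by apply: eq_bigr => l _; exact: mulNr.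
Qed.

Lemma ps_mulNr a b : ps_mul a (- b) = - ps_mul a b.
Proof. by rewrite ps_mulC ps_mulNl ps_mulC. Qed.

Lemma ps_sumE (I : finType) (F : I -> fps R N) m :
  (\sum_i F i) m = \sum_i F i m.
Proof. exact: (big_morph (fun f : fps R N => f m)). Qed.

Lemma ps_mul_sumr (I : finType) a (F : I -> fps R N) :
  ps_mul a (\sum_i F i) = \sum_i ps_mul a (F i).
Proof.
elim/big_ind2: _ => [|x x' y y' <- <-|//]; last by rewrite ps_mulDr.
by apply/funext => m; rewrite ps_mulE big1// => l _; rewrite mulr0.
Qed.

Lemma ps_derivD i a b : ps_deriv i (a + b) = ps_deriv i a + ps_deriv i b.
Proof. by apply/funext => m; exact: mulrDr. Qed.

Lemma ps_derivN i a : ps_deriv i (- a) = - ps_deriv i a.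
Proof. by apply/funext => m; exact: mulrN. Qed.

Lemma ps_deriv_sum (I : finType) i (F : I -> fps R N) :
  ps_deriv i (\sum_j F j) = \sum_j ps_deriv i (F j).
Proof.
elim/big_ind2: _ => [|x x' y y' <- <-|//]; last by rewrite ps_derivD.
by apply/funext => m; rewrite /ps_deriv mulr0.
Qed.

Lemma ps_derivE i a m : ps_deriv i a m = (m i).+1%:R * a (madd (munit i) m).
Proof.
rewrite /ps_deriv; congr (_ * a _); apply/ffunP => j.
by rewrite !ffunE addnC.
Qed.

Lemma ps_derivC i j a : ps_deriv i (ps_deriv j a) = ps_deriv j (ps_deriv i a).
Proof.
apply/funext => m; rewrite !ps_derivE !ffunE !maddA (maddC (munit j)) eq_sym.
case: (eqVneq j i) => [-> //|_]; rewrite !add0n !mulrA; congr (_ * _).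
exact: mulrC.
Qed.

(* Coefficient by coefficient, the Leibniz rule is the splitting of the
   exponent (l + l') i as l i + l' i. *)
Lemma ps_deriv_half i a b m :
  \sum_(l <- below (madd (munit i) m))
     (l i)%:R * a l * b (msub (madd (munit i) m) l)
  = ps_mul (ps_deriv i a) b m.
Proof.
rewrite ps_mulE (bigID (mle (munit i))) /= addrC.
rewrite big1 ?add0r => [|l]; last first.
  by rewrite mle_munit lt0n negbK => /eqP ->; rewrite !mul0r.
rewrite -big_filter (perm_big _ (perm_below_add (mle_addr _ _))) big_map maddK.
apply: eq_bigr => l _; rewrite ps_derivE ffunE ffunE eqxx add1n.
congr (_ * b _); apply/ffunP => j; rewrite !ffunE subnDl //.
Qed.

Lemma ps_deriv_mul i a b : ps_deriv i (ps_mul a b) =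
  ps_mul (ps_deriv i a) b + ps_mul a (ps_deriv i b).
Proof.
apply/funext => m; rewrite -[RHS]/(ps_mul _ b m + ps_mul a _ m).
rewrite (ps_mulC a (ps_deriv i b)) -!ps_deriv_half ps_derivE.
rewrite [X in _ + X](perm_big _ (perm_below_sub _)) [X in _ + X]big_map /=.
rewrite ps_mulE mulr_sumr -big_split /= big_seq [RHS]big_seq.
apply: eq_bigr => l; rewrite mem_below => le_l.
have l_le := mleP _ _ le_l i; rewrite (msubK le_l).
rewrite -!mulrA [a l * _]mulrC -mulrDl; congr (_ * _).
by rewrite -natrD ffunE subnKC // !ffunE eqxx.
Qed.

End PowerSeriesRing.

(** * Vector fields as derivations *)

Section VectorFields.
Variables (R : realType) (N : nat).
Local Notation vf := (vfield R N).
Implicit Types (X Y Z : vf) (f g : fps R N).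

Definition vf_der X f : fps R N := \sum_j ps_mul (X j) (ps_deriv j f).

Lemma vf_bracketE X Y i : vf_bracket X Y i = vf_der X (Y i) - vf_der Y (X i).
Proof.
apply/funext => m; rewrite /vf_bracket /vf_der.
rewrite -[RHS]/((\sum_j ps_mul (X j) _) m - (\sum_j ps_mul (Y j) _) m).
by rewrite !ps_sumE sumrB.
Qed.

Lemma vf_derD X f g : vf_der X (f + g) = vf_der X f + vf_der X g.
Proof.
by rewrite -big_split; apply: eq_bigr => j _; rewrite ps_derivD ps_mulDr.
Qed.

Lemma vf_derN X f : vf_der X (- f) = - vf_der X f.
Proof.
by rewrite -sumrN; apply: eq_bigr => j _; rewrite ps_derivN ps_mulNr.
Qed.

(** In the commutator the second-order terms cancel, because partial derivatives commute. *)
Lemma vf_der_bracket X Y f : vf_der (vf_bracket X Y) f =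
  vf_der X (vf_der Y f) - vf_der Y (vf_der X f).
Proof.
have der2 X' Y' : vf_der X' (vf_der Y' f) =
    \sum_j ps_mul (vf_der X' (Y' j)) (ps_deriv j f) +
    \sum_j \sum_k ps_mul (X' j) (ps_mul (Y' k) (ps_deriv j (ps_deriv k f))).
  rewrite /vf_der; under [LHS]eq_bigr do rewrite ps_deriv_sum ps_mul_sumr.
  under [in RHS]eq_bigr => j _ do rewrite ps_mulC ps_mul_sumr.
  rewrite [X in X + _]exchange_big -big_split /=; apply: eq_bigr => j _.
  rewrite -big_split /=; apply: eq_bigr => k _.
  by rewrite ps_deriv_mul ps_mulDr ps_mulA ps_mulC.
rewrite !der2 [X in _ - (_ + X)]exchange_big /=.
rewrite [X in _ - (_ + X)](_ : _ = \sum_j \sum_k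
    ps_mul (X j) (ps_mul (Y k) (ps_deriv j (ps_deriv k f)))); last first.
  apply: eq_bigr => j _; apply: eq_bigr => k _.
  by rewrite !ps_mulA (ps_mulC (Y _)) ps_derivC.
rewrite opprD addrACA subrr addr0 -sumrB; apply: eq_bigr => j _.
by rewrite vf_bracketE ps_mulDl ps_mulNl.
Qed.

Lemma vf_bracket_anti X Y : vf_bracket X Y = - vf_bracket Y X.
Proof.
apply/funext => i; rewrite -[RHS]/(- vf_bracket Y X i) !vf_bracketE.
by rewrite opprB.
Qed.

(** Once brackets act as commutators, each component is a linear identity between iterated
    derivatives. *)
Lemma vf_jacobi X Y Z : vf_bracket X (vf_bracket Y Z) =
  vf_bracket (vf_bracket X Y) Z + vf_bracket Y (vf_bracket X Z).
Proof.
apply/funext => i; rewrite -[RHS]/(_ i + _ i) !vf_bracketE !vf_der_bracket.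
rewrite !vf_derD !vf_derN; apply/funext => m.
rewrite -[RHS]/((_ m - _ m - (_ m - _ m)) + (_ m - _ m - (_ m - _ m))).
rewrite -[LHS]/(_ m - _ m - (_ m - _ m)).
by ring.
Qed.

Definition ps_scale (a : R[i]) f : fps R N := fun m => a * f m.

Lemma ps_scale_mull a f g : ps_mul (ps_scale a f) g = ps_scale a (ps_mul f g).
Proof.
apply/funext => m; rewrite /ps_scale !ps_mulE mulr_sumr.
by apply: eq_bigr => l _; rewrite mulrA.
Qed.

Lemma ps_scale_mulr a f g : ps_mul f (ps_scale a g) = ps_scale a (ps_mul f g).
Proof. by rewrite ps_mulC ps_scale_mull ps_mulC. Qed.

Lemma ps_scale_deriv i a f :
  ps_deriv i (ps_scale a f) = ps_scale a (ps_deriv i f).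
Proof. by apply/funext => m; rewrite /ps_scale !ps_derivE mulrCA. Qed.

Lemma vf_scaleE (a : R) X i m : (a *: X) i m = a%:C * X i m.
Proof.
rewrite -[LHS]/(ComplexField.scalec a (X i m)).
by case: (X i m) => x y; rewrite /ComplexField.scalec; simpc.
Qed.

Lemma vf_der_scale a X f : vf_der X (ps_scale a f) = ps_scale a (vf_der X f).
Proof.
apply/funext => m; rewrite /ps_scale /vf_der !ps_sumE mulr_sumr.
by apply: eq_bigr => j _; rewrite ps_scale_deriv ps_scale_mulr.
Qed.

Lemma vf_der_scalel (a : R) X f :
  vf_der (a *: X) f = ps_scale a%:C (vf_der X f).
Proof.
apply/funext => m; rewrite /ps_scale /vf_der !ps_sumE mulr_sumr.
apply: eq_bigr => j _; rewrite -[RHS]/(ps_scale _ _ m) -ps_scale_mull.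
by congr (ps_mul _ _ m); apply/funext => l; exact: vf_scaleE.
Qed.

Lemma vf_derDl X Y f : vf_der (X + Y) f = vf_der X f + vf_der Y f.
Proof. by rewrite -big_split; apply: eq_bigr => j _; exact: ps_mulDl. Qed.

Lemma vf_bracket_linear X (a : R) Y Z :
  vf_bracket X (a *: Y + Z) = a *: vf_bracket X Y + vf_bracket X Z.
Proof.
apply/funext => i; apply/funext => m; rewrite vf_bracketE.
rewrite -[RHS]/((a *: vf_bracket X Y) i m + vf_bracket X Z i m) vf_scaleE.
rewrite vf_derDl vf_der_scalel !vf_bracketE.
rewrite (_ : (a *: Y + Z) i = ps_scale a%:C (Y i) + Z i); last first.
  by apply/funext => l; rewrite -[LHS]/((a *: Y) i l + Z i l) vf_scaleE.
rewrite vf_derD vf_der_scale.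
rewrite -[LHS]/((_ * _ m + _ m) - (_ * _ m + _ m)).
rewrite -[RHS]/(_ * (_ m - _ m) + (_ m - _ m)).
by ring.
Qed.
End VectorFields.

(** * The Euler field and weighted degrees *)

Section Euler.
Variables (R : realType) (N : nat).
Implicit Types (f g : fps R N).

Definition ps_mono (l : mindex N) (a : R[i]) : fps R N :=
  fun m => if m == l then a else 0.

Lemma ps_mul_mono l a g m :
  ps_mul (ps_mono l a) g m = if mle l m then a * g (msub m l) else 0.
Proof.
rewrite ps_mulE; case: ifP => le_lm; last first.
  rewrite big_seq big1// => p; rewrite mem_below /ps_mono.
  by case: eqP => [-> |]; rewrite ?le_lm // mul0r.
rewrite (bigD1_seq l) ?below_uniq ?mem_below//= /ps_mono eqxx big1 ?addr0//.
by move=> p /negPf ->; rewrite mul0r.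
Qed.

Lemma ps_mul_mono0 a g m : ps_mul (ps_mono [ffun=> 0%N] a) g m = a * g m.
Proof.
have le0m : mle [ffun=> 0%N] m by apply/mleP => j; rewrite ffunE.
rewrite ps_mul_mono le0m; congr (_ * g _).
by apply/ffunP => j; rewrite !ffunE subn0.
Qed.

End Euler.

Section Weights.
Variables (R : realType) (n k : nat).
Local Notation vf := (vfield R (n + k)).
Local Notation wt := (@wt n k).
Implicit Types (X Y : vf) (m : mindex (n + k)).

Definition wdeg m := (\sum_j m j * wt j)%N.

(** The j-th summand of the Euler operator multiplies a monomial by [wt j] times its j-th
    exponent. *)
Lemma vf_der_euler (f : fps R (n + k)) m :
  vf_der euler f m = (wdeg m)%:R * f m.
Proof.
rewrite /vf_der ps_sumE natr_sum mulr_suml; apply: eq_bigr => j _.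
rewrite (ps_mul_mono (munit j) (wt j)%:R) mle_munit.
case: posnP => [->|mj_gt0]; first by rewrite mul0n mul0r.
have le_jm : mle (munit j) m by rewrite mle_munit.
rewrite ps_derivE (msubKC le_jm) !ffunE eqxx subn1 prednK// natrM.
by rewrite mulrA [_ * (m j)%:R]mulrC.
Qed.

Lemma ps_deriv_euler i j : ps_deriv j (euler i : fps R (n + k)) =
  ps_mono [ffun=> 0%N] (if j == i then (wt i)%:R else 0).
Proof.
apply/funext => l; rewrite ps_derivE /euler /ps_mono -/(munit i).
case: eqP => [e|ne].
  have := congr1 (fun p : mindex _ => p j) e.
  rewrite !ffunE eqxx; case: eqP => // ji [lj0].
  have -> : l = [ffun=> 0%N].
    by apply: (@madd_inj _ (munit i)); rewrite -{1}ji e; apply/ffunP => p;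
       rewrite !ffunE addn0.
  by rewrite eqxx ffunE mul1r.
rewrite mulr0; case: eqP => // l0; case: eqP => // ji.
by case: ne; rewrite l0 ji; apply/ffunP => p; rewrite !ffunE addn0.
Qed.

Lemma vf_der_of_euler X i m : vf_der X (euler i) m = (wt i)%:R * X i m.
Proof.
rewrite /vf_der ps_sumE (bigD1 i)//= big1 ?addr0 => [|j /negPf j_i].
  by rewrite ps_mulC ps_deriv_euler eqxx ps_mul_mono0.
by rewrite ps_mulC ps_deriv_euler j_i ps_mul_mono0 mul0r.
Qed.

Lemma vf_bracket_euler X i m :
  vf_bracket euler X i m = ((wdeg m)%:R - (wt i)%:R) * X i m.
Proof.
rewrite vf_bracketE -[LHS]/(_ m - _ m) vf_der_euler vf_der_of_euler.
by rewrite mulrBl.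
Qed.

Lemma gr_weight (A : set vf) (b : int) X i m : gr A b X -> X i m != 0 ->
  (wdeg m)%:Z - (wt i)%:Z = b.
Proof.
case=> _ eX X0; have := congr1 (fun Y : vf => Y i m) eX.
rewrite vf_bracket_euler vf_scaleE => /(mulIf X0) e {eX}.
apply: (@intr_inj R); apply: (@complexI R); rewrite rmorph_int -e.
by rewrite rmorphB.
Qed.

Lemma gr_weighted_homogeneous A (b : int) X :
  gr A b X -> weighted_homogeneous b%:~R X.
Proof.
move=> gX i m /eqP X0; rewrite -(gr_weight gX X0) rmorphB /=.
by rewrite -/(wdeg m).
Qed.

Lemma wt_gt0 i : (0 < wt i)%N. Proof. by rewrite /wt; case: fintype.split. Qed.
Lemma wt_le2 i : (wt i <= 2)%N. Proof. by rewrite /wt; case: fintype.split. Qed.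

Lemma wdeg_le m : (wdeg m <= 2 * mdegree m)%N.
Proof.
rewrite /mdegree big_distrr /=; apply: leq_sum => j _.
by rewrite mulnC leq_mul2r wt_le2 orbT.
Qed.

Lemma leq_wdeg m i : (m i <= wdeg m)%N.
Proof.
by rewrite /wdeg (bigD1 i)//= (leq_trans _ (leq_addr _ _))// leq_pmulr ?wt_gt0.
Qed.

(** Let K be the floor. For [m] of degree at most K - 1, the weighted degree is at most 2K - 2 <= b,
    whereas a nonzero coefficient needs weighted degree [b + wt i], which exceeds b. *)
Lemma gr_jet_determined A (b : int) X : gr A b X ->
  at_least_jet_determined (Num.floor ((b%:~R + 2) / 2 : R)) X.
Proof.
move=> gX i m le_m; apply/eqP/negP => /negP X0.
have := gr_weight gX X0; have := wdeg_le m; have := wt_gt0 i.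
set K := Num.floor _ in le_m; have : (K%:~R <= (b%:~R + 2) / 2 :> R).
  exact: floor_le.
rewrite ler_pdivlMr// -[2 in X in _ <= X]/(2%:~R) -intrD.
rewrite -[2]/(2%:~R) -intrM ler_int.
by lia.
Qed.

End Weights.

Lemma vf_lie_bracket (R : realType) N : lie_bracket (@vf_bracket R N).
Proof.
split; first by move=> X a Y Z; exact: vf_bracket_linear.
- exact: vf_bracket_anti.
- exact: vf_jacobi.
Qed.

Lemma lie_bracket_self (K : numFieldType) (V : lmodType K)
    (br : V -> V -> V) x :
  lie_bracket br -> br x x = 0.
Proof.
move=> brL; have := br_anti brL x x; move/eqP; rewrite -addr_eq0 -mulr2n.
by rewrite -scaler_nat scaler_eq0 pnatr_eq0 => /eqP.
Qed.

Lemma sub_lspan (K : fieldType) (V : lmodType K) (S : set V) : S `<=` lspan S.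
Proof. by move=> x Sx A [_]; apply. Qed.

Lemma lspan_min (K : fieldType) (V : lmodType K) (S A : set V) :
  subspace A -> S `<=` A -> lspan S `<=` A.
Proof. by move=> sA SA x; apply. Qed.

Lemma subspace_bigcap (K : fieldType) (V : lmodType K) (D : set (set V)) :
  (forall A, D A -> subspace A) -> subspace (\bigcap_(A in D) A).
Proof.
move=> sD; split=> [A /sD/subspace0 //|a x y Dx Dy A DA].
by apply: (sD _ DA).2; [exact: Dx|exact: Dy].
Qed.

Lemma subspace_lspan (K : fieldType) (V : lmodType K) (S : set V) :
  subspace (lspan S).
Proof. by apply: subspace_bigcap => A []. Qed.

(** Real coefficients require two generators for each monomial field; the boolean in the index
    selects the factor 1 or i. *)
Lemma findim_bounded_exponents (R : realType) N (D : nat) :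
  findim [set X : vfield R N | forall i m, X i m != 0 -> forall j, (m j < D)%N].
Proof.
pose I := ('I_N * {ffun 'I_N -> 'I_D} * bool)%type.
pose e (t : I) : vfield R N := fun i m =>
  if (i == t.1.1) && (m == box_index t.1.2) then (if t.2 then 1 else 'i) else 0.
apply: (@findim_finType _ _ _ I e) => X XD.
pose a (t : I) : R := let z := X t.1.1 (box_index t.1.2) in
  if t.2 then complex.Re z else complex.Im z.
exists a; apply/funext => i; apply/funext => m.
rewrite (big_morph (fun Y : vfield R N => Y i m) (id1 := 0) (op1 := +%R))//.
under eq_bigr do rewrite vf_scaleE.
have [X0|X0] := eqVneq (X i m) 0.
  rewrite X0 big1// => t _; rewrite /e; case: ifP => [/andP[/eqP it /eqP mt]|].
    by rewrite /a -it -mt X0; case: (t.2); rewrite mul0r.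
  by rewrite mulr0.
pose l : {ffun 'I_N -> 'I_D} := [ffun j => Ordinal (XD i m X0 j)].
have ml : m = box_index l by apply/ffunP => j; rewrite !ffunE.
have ne : (i, l, false) != (i, l, true) by rewrite xpair_eqE andbF.
rewrite (bigD1 (i, l, true))//= (bigD1 (i, l, false) ne)/= big1 => [|t].
  rewrite /e /a /= eqxx -ml eqxx /= mulr1 addr0 mulrC.
  by rewrite [LHS]complexE.
case: t => [[j q] b] /= /andP[t1 t2]; rewrite /e /=.
case: ifP => [/andP[/eqP ij /eqP mq]|]; last by rewrite mulr0.
have ql : q = l by apply: (@box_index_inj _ D); rewrite -mq.
by move: t1 t2; rewrite ql -ij; case: (b); rewrite eqxx.
Qed.

(** * Graded representations *)

Section GradedModule.
Variables (R : realType) (n k : nat).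
Local Notation vf := (vfield R (n + k)).
Local Notation br := (@vf_bracket R (n + k)).
Local Notation cbr := (cplx_br br).
Local Notation E := (@euler R n k).
Implicit Types (A s W : set vf) (X Y w : vf).

Let brL : lie_bracket br := @vf_lie_bracket R (n + k).
Let cbrL : lie_bracket cbr := cplx_lie_bracket brL.

(** An exponent is at most the weighted degree of its monomial, which is at most [hi + 2] since
    components weigh at most 2. *)
Lemma graded_findim A (lo hi : int) : graded A lo hi -> findim A.
Proof.
case=> lohi gA.
apply: findim_sub (findim_bounded_exponents R (n + k) (`|hi| + 3)).
move=> X /gA[Y gY ->] i m.
rewrite (big_morph (fun Z : vf => Z i m) (id1 := 0) (op1 := +%R))// => X0 j.
have : exists p : 'I_`|hi - lo|.+1, Y (lo + p%:Z) i m != 0.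
  apply/existsP; apply: contraNT X0; rewrite negb_exists => /forallP Y0.
  by rewrite big1// => p _; apply/eqP; rewrite -[_ == 0]negbK.
case=> p Y0; have := gr_weight (gY _) Y0.
by have := ltn_ord p; have := wt_le2 i; have := leq_wdeg m j; lia.
Qed.

Lemma graded_bracket_euler A lo hi X : subspace A -> graded A lo hi ->
  A X -> A (br E X).
Proof.
move=> sA [_ gA] /gA[Y gY ->].
rewrite (br_sumr brL); apply: subspace_sum => // i _.
by have [AY ->] := gY (lo + i%:Z); exact: subspaceZ.
Qed.

(** Split [v] into components with distinct integer eigenvalues. By [eigen_components] each of them
    lies in the [mu]-eigenspace, and a nonzero one forces [mu] to be its integer. *)
Lemma graded_eigenvalue A (lo hi : int) (v : cplx vf) (mu : R[i]) :
  graded A lo hi -> cplx_set A v -> v <> 0 -> cbr (cplx_in E) v = mu *: v ->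
  exists b : int, lo <= b <= hi /\ mu = b%:~R.
Proof.
case=> lohi gA [/gA[Y gY v1] /gA[Z gZ v2]] v0 ev.
pose w (i : 'I_`|hi - lo|.+1) : cplx vf := (Y (lo + i%:Z), Z (lo + i%:Z)).
pose nu (i : 'I_`|hi - lo|.+1) : R[i] := (lo + i%:Z)%:~R.
have vw : v = \sum_i w i.
  by rewrite [v]surjective_pairing v1 v2 cplx_sumE.
have ew i : cbr (cplx_in E) (w i) = nu i *: w i.
  rewrite cplx_br_in// (gY _).2 (gZ _).2.
  by rewrite /nu -(rmorph_int (real_complex R)) cplx_scale_real.
pose B : set (cplx vf) := eigensp cbr setT (cplx_in E) mu.
have Bw i : B (w i).
  apply: (eigen_components (br_linr cbrL (cplx_in E)) (r := index_enum _)
            (nu := nu)) => //.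
  - by apply: subspace_eigensp.
  - by move=> x [_ ex]; split=> //; rewrite ex (brZr cbrL) ex.
  - rewrite map_inj_uniq ?index_enum_uniq// => p q /intr_inj /addrI [pq].
    exact: val_inj.
  - by split=> //; rewrite -vw.
have [i wi0] : exists i, w i <> 0.
  apply: contrapT => no; apply: v0; rewrite vw big1// => i _.
  by apply: contrapT => wi0; apply: no; exists i.
exists (lo + i%:Z); split; first by have := ltn_ord i; lia.
have := (Bw i).2; rewrite ew => /eqP; rewrite -subr_eq0 -scalerBl scaler_eq0.
by move=> /orP[|/eqP//]; rewrite subr_eq0 => /eqP.
Qed.

(** * An irreducible representation of the Levi factor *)

Section LeviRepresentation.
Variables (s W : set vf) (Es : vf) (c : int).
Hypotheses (ss : subspace s) (sLie : forall X Y, s X -> s Y -> s (br X Y)).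
Hypotheses (semis : lie_semisimple br s) (gs : graded s (-2) 2).
Hypotheses (hEs : grading_element s Es) (irrW : irreducible_subrep br s W).
Hypothesis gW : graded W (-2) c.

Let sW : subspace W. Proof. by case: irrW => -[]. Qed.
Let sEs : s Es. Proof. by case: hEs. Qed.
Let WsW X w : s X -> W w -> W (br X w).
Proof. by case: irrW => -[_ +] _ _; exact. Qed.

Lemma euler_grading_element X : s X -> br E X = br Es X.
Proof.
case: gs => _ gs' /gs'[Y gY ->]; rewrite !(br_sumr brL); apply: eq_bigr => i _.
by rewrite (hEs.2 _ _ (gY _)) (gY _).2.
Qed.

Definition shift w := br Es w - br E w.

Lemma shift_linear : linear shift.
Proof.
move=> a x y; rewrite /shift !(br_linr brL) scalerBr opprD -!addrA.
by congr (_ + _); rewrite addrCA.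
Qed.

Lemma shift_br X w : s X -> shift (br X w) = br X (shift w).
Proof.
move=> sX; rewrite /shift (br_jacobi brL Es) (br_jacobi brL E).
rewrite euler_grading_element// opprD addrACA subrr add0r.
by rewrite (brDr brL) -scaleN1r -(brZr brL) scaleN1r.
Qed.

Lemma shift_euler w : shift (br E w) = br E (shift w).
Proof.
rewrite /shift (br_jacobi brL Es) (brDr brL).
rewrite -[in RHS]scaleN1r (brZr brL) scaleN1r (br_anti brL Es E).
rewrite euler_grading_element// (lie_bracket_self _ brL) oppr0.
by rewrite (br0l brL) add0r.
Qed.

Lemma shift_stable w : W w -> W (shift w).
Proof.
move=> Ww; apply: subspaceD => //; first exact: WsW.
by apply: subspaceN => //; exact: graded_bracket_euler gW Ww.
Qed.

Lemma shift_scalar : exists lam : R,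
  forall w, W w -> br Es w = br E w + lam *: w.
Proof.
pose WC := cplx_set W; have sWC : subspace WC by exact: subspace_cplx_set.
pose T (p : cplx vf) : cplx vf := (shift p.1, shift p.2).
have TE p : T p = cbr (cplx_in Es) p - cbr (cplx_in E) p.
  by rewrite !cplx_br_in.
have linT : linear T.
  move=> a p q; rewrite !TE !(br_linr cbrL) scalerBr opprD -!addrA.
  by congr (_ + _); rewrite addrCA.
have stT : stable_linear WC T.
  by split=> // p [Wp1 Wp2]; split; exact: shift_stable.
have fWC : findim WC by apply/findim_cplx_set/graded_findim/gW.
have WC0 : WC <> [set 0].
  case: irrW => _ W0 _; have [x Wx x0] := nonzero_of_neq0 sW W0 => WC0.
  have : WC (cplx_in x) by split=> //; exact: subspace0.
  by rewrite WC0 => -[].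
have [d [e eWC]] := findim_basis sWC fWC.
have d_gt0 := is_basis_dim_gt0 sWC eWC WC0.
have [mu /(eigenvalue_mx_of sWC eWC stT)[v [Wv v0 Tv]]] :=
  closed_eigenvalue (mx_of e T) d_gt0.
pose U := [set p | WC p /\ T p = mu *: p].
have sU : subspace U.
  split; first by split; [exact: subspace0|rewrite (linear_fun0 linT) scaler0].
  move=> a p q [Wp Tp] [Wq Tq]; split; first exact: sWC.2.
  by rewrite linT Tp Tq scalerDr !scalerA mulrC.
have stU X : stable_linear W (br X) ->
    (forall w, shift (br X w) = br X (shift w)) ->
    stable_linear U (cbr (cplx_in X)).
  move=> [_ stX] comX; split; first exact: br_linr.
  move=> p [[W1 W2] Tp]; split.
    by rewrite cplx_br_in//; split; exact: stX.
  rewrite -(brZr cbrL) -Tp !cplx_br_in//.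
  by rewrite /T /= !comX.
have stUs X : s X -> stable_linear U (cbr (cplx_in X)).
  move=> sX; apply: stU => [|w]; last exact: shift_br.
  by split=> [|w]; [exact: br_linr|exact: WsW].
have stUE : stable_linear U (cbr (cplx_in E)).
  apply: stU => [|w]; last exact: shift_euler.
  by split=> [|w]; [exact: br_linr|exact: graded_bracket_euler gW].
have fU : findim U by apply: findim_sub fWC => p [].
have [r [f fUb]] := findim_basis sU fU.
have U0 : U <> [set 0].
  by move=> U0; apply: v0; have : U v by []; rewrite U0.
have r_gt0 := is_basis_dim_gt0 sU fUb U0.
(* The elements of trace 0 on [U] form a subspace; it contains all brackets of [s], hence [s] itself
   by perfectness. *)
pose Z := [set X | s X /\ \tr (mx_of f (cbr (cplx_in X))) = 0].
have sZ : subspace Z.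
  split.
    split; first exact: subspace0.
    rewrite (_ : cbr _ = fun p => 0 *: p).
      by rewrite (mx_of_scale sU fUb) mxtrace_scalar mul0rn.
    by apply/funext => p; rewrite (br0l cbrL) scale0r.
  move=> a X Y [sX tX] [sY tY]; split; first exact: ss.2.
  rewrite (_ : cbr _ = fun p => a%:C *: cbr (cplx_in X) p + cbr (cplx_in Y) p).
    rewrite (mx_of_linear sU fUb _ (stUs _ sX) (stUs _ sY)) raddfD /=.
    by rewrite mxtraceZ tX tY mulr0 addr0.
  apply/funext => p; rewrite -(br_linl cbrL); congr (cbr _ _).
  rewrite cplx_scale_real; congr (_, _) => /=.
  by rewrite scaler0 addr0.
have [_ tEs] : Z Es.
  suff sZs : s `<=` Z by exact: sZs.
  apply: (semisimple_perfect semis sZ) => X Y sX sY.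
  split; first exact: sLie.
  have XY : cplx_in (br X Y) = cbr (cplx_in X) (cplx_in Y).
    by rewrite cplx_br_in// /= (br0r brL).
  rewrite (_ : cbr _ = fun p => -1 *: cbr (cplx_in Y) (cbr (cplx_in X) p) +
       cbr (cplx_in X) (cbr (cplx_in Y) p)); last first.
    apply/funext => p; rewrite scaleN1r XY (br_jacobi cbrL (cplx_in X)).
    by rewrite addrC addrK.
  have st2 X' Y' : s X' -> s Y' ->
      stable_linear U (fun p => cbr (cplx_in X') (cbr (cplx_in Y') p)).
    move=> /stUs[l1 U1] /stUs[l2 U2]; split=> [a p q|p /U2/U1//].
    by rewrite l2 l1.
  rewrite (mx_of_linear sU fUb)//; [|exact: st2|exact: st2].
  rewrite !(mx_of_comp sU fUb)//; [|exact: stUs..].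
  by rewrite scaleN1r raddfD raddfN /= mxtrace_mulC addNr.
(* This is the trace of Es = mu + E on [U], whose dimension is [r]. *)
have trE : mu *+ r + \tr (mx_of f (cbr (cplx_in E))) = 0.
  rewrite -tEs (mx_of_ext fUb (f := cbr (cplx_in Es))
    (g := fun p => 1 *: (mu *: p) + cbr (cplx_in E) p)).
    have stmu : stable_linear U (fun p => mu *: p).
      split=> [a p q|p]; last exact: subspaceZ.
      by rewrite scalerDr !scalerA mulrC.
    rewrite (mx_of_linear sU fUb _ stmu stUE).
    by rewrite scale1r raddfD /= (mx_of_scale sU fUb) mxtrace_scalar.
  by move=> p [_ <-]; rewrite scale1r TE subrK.
have imE : complex.Im (\tr (mx_of f (cbr (cplx_in E)))) = 0.
  apply: (@trace_of_eigenvalues _ _ _ [set z | complex.Im z = 0]) => //.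
    by move=> [a a'] [b b'] /= -> ->; rewrite addr0.
  move=> z /(eigenvalue_mx_of sU fUb stUE)[p [[Wp _] p0 Ep]].
  have [b [_ ->]] := graded_eigenvalue gW Wp p0 Ep.
  by rewrite -(rmorph_int (real_complex R)).
have muE : mu = (complex.Re mu)%:C.
  have : complex.Im (mu *+ r) = 0.
    by move/eqP: trE; rewrite addr_eq0 => /eqP ->; rewrite raddfN /= imE oppr0.
  rewrite raddfMn /= => /eqP; rewrite mulrn_eq0 eqn0Ngt r_gt0 /= => /eqP.
  by case: (mu) => x y /= ->.
exists (complex.Re mu); set lam := complex.Re mu.
(* Since [mu] is real, the real and imaginary parts of [v] are themselves eigenvectors of [shift] in
   [W], so this subrepresentation is not zero. *)
pose W' := [set w | W w /\ shift w = lam *: w].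
have repW' : subrep br s W'.
  split; first split.
  - by split; [exact: subspace0|rewrite (linear_fun0 shift_linear) scaler0].
  - move=> a x y [Wx Tx] [Wy Ty]; split; first exact: sW.2.
    by rewrite shift_linear Tx Ty scalerDr !scalerA mulrC.
  - move=> X w sX [Ww Tw]; split; first exact: WsW.
    by rewrite shift_br// Tw (brZr brL).
have W'W : W' `<=` W by move=> w [].
have [W'0|W'E] : W' = [set 0] \/ W' = W by case: irrW => _ _; apply.
  case: v0; move: Tv Wv; rewrite muE cplx_scale_real.
  case: v => x y [Tx Ty] [Wx Wy].
  have : W' x by []; have : W' y by [].
  by rewrite W'0 /= => -> ->.
by move=> w; rewrite -W'E => -[_ <-]; rewrite addrC subrK.
Qed.

(* With sg = 1 (resp. -1): a vector killed by the part of s of positive (resp.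
   negative) degree generates W under the opposite part, so that its degree
   bounds all degrees in W. *)
Lemma extremal_degree (sg b b' : int) X Y :
  gr W b X -> X <> 0 ->
  (forall j Z, -2 <= j <= 2 -> 0 < sg * j -> gr s j Z -> br Z X = 0) ->
  gr W b' Y -> Y <> 0 -> sg * b' <= sg * b.
Proof.
move=> [WX eX] X0 killX gY Y0.
pose low (A : set vf) :=
  forall j Z w, sg * j <= 0 -> gr s j Z -> A w -> A (br Z w).
pose D := [set A : set vf | [/\ subspace A, A X & low A]].
pose U : set vf := \bigcap_(A in D) A.
have sU : subspace U by apply: subspace_bigcap => A [].
have UX : U X by move=> A [].
have lowU : low U.
  move=> j Z w j0 gZ Uw A DA; have [_ _ lowA] := DA.
  by apply: (lowA j) => //; exact: Uw.
have UW : U `<=` W.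
  by move=> w Uw; apply: (Uw W); split=> // j Z v _ [sZ _]; exact: WsW.
(* To see that [U] is stable under all of [s], the vectors of [U] that [s] maps into [U] are shown
   to satisfy the conditions defining [U]; minimality concludes. This replaces an ordering of
   products as in the Poincaré-Birkhoff-Witt theorem. *)
pose Us := [set w | U w /\ forall Z, s Z -> U (br Z w)].
have DUs : D Us.
  split.
  - split; first by split=> [|Z _]; rewrite ?(br0r brL); exact: subspace0.
    move=> a v w [Uv sv] [Uw sw]; split; first exact: sU.2.
    by move=> Z sZ; rewrite (br_linr brL); apply: sU.2; [exact: sv|exact: sw].
  - split=> // Z sZ; case: gs => _ /(_ Z sZ)[F gF ->]; rewrite (br_suml brL).
    apply: subspace_sum => // i _; have [j0|j0] := ltP 0 (sg * (-2 + i%:Z)).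
      rewrite (killX _ _ _ j0 (gF _)); first exact: subspace0.
      by have := ltn_ord i; lia.
    exact: (lowU _ _ _ j0 (gF _)).
  - move=> j Z w j0 gZ [Uw sw]; have [sZ _] := gZ; split.
      exact: (lowU _ _ _ j0 gZ).
    (* Z'(Z w) = [Z', Z] w + Z (Z' w): the first term is in [U] because [w] is in [Us], the second
       because [U] is stable under [Z]. *)
    move=> Z' sZ'; rewrite (br_jacobi brL); apply: (subspaceD sU).
      by apply: sw; exact: sLie.
    by apply: (lowU _ _ _ j0 gZ); exact: sw.
have repU : subrep br s U by split=> // Z w sZ Uw; have [_] := Uw _ DUs; apply.
have U0 : U <> [set 0] by move=> U0; apply: X0; move: UX; rewrite U0.
have UE : U = W by case: irrW => _ _ /(_ U repU UW)[].
(* The span of the eigenvectors of E within the degree bound also satisfies the conditions defining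
   [U], so it contains [W]. *)
pose S := [set w | exists d : int, sg * d <= sg * b /\ br E w = d%:~R *: w].
have sS := subspace_lspan S.
have DS : D (lspan S).
  split=> //; first by apply: sub_lspan; exists b.
  move=> j Z w j0 [_ eZ] Sw.
  suff sub : lspan S `<=` [set v | lspan S (br Z v)] by exact: sub.
  apply: lspan_min => [|v [d [db ev]]].
    split; first by rewrite /= (br0r brL); exact: subspace0.
    by move=> a u v Su Sv; rewrite /= (br_linr brL); exact: sS.2.
  apply: sub_lspan; exists (j + d); split; first by rewrite mulrDr; lia.
  by rewrite (br_jacobi brL) eZ ev (brZl brL) (brZr brL) -scalerDl rmorphD.
have SY : lspan S Y by have [WY _] := gY; move: WY; rewrite -UE => /(_ _ DS).
apply: contrapT => nle; apply: Y0; apply/funext => i; apply/funext => m.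
apply/eqP/negPn/negP => Yim; apply: nle.
have wY := gr_weight gY Yim.
rewrite -wY.
(* A single coefficient detects the degree: if the monomial [m] in component [i] violated the bound,
   its coefficient would vanish on the whole span, but it does not vanish in [Y]. *)
pose C := [set w : vf | sg * ((wdeg m)%:Z - (wt i)%:Z) <= sg * b \/ w i m = 0].
suff sub : lspan S `<=` C by case: (sub _ SY) => // Y0; rewrite Y0 eqxx in Yim.
apply: lspan_min => [|w [d [db ew]]].
  split=> [|a v w [?|v0] [?|w0]]; [by right|by left|by left|by left|right].
  by rewrite -[LHS]/((a *: v) i m + w i m) vf_scaleE v0 w0 mulr0 add0r.
have [w0|w0] := eqVneq (w i m) 0; [by right|left].
by rewrite (gr_weight (A := setT) (conj I ew) w0).
Qed.

Variable lam : R.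
Hypothesis EsE : forall w, W w -> br Es w = br E w + lam *: w.
Variable h : set (cplx vf).
Hypotheses (hh : cartan_subalgebra cbr (cplx_set s) h) (hEsh : h (cplx_in Es)).

(** The parameters [sg] and [Q] let one statement cover highest weight vectors (1 and [P]) and
    lowest ones (-1 and [opp_roots P]). *)
Lemma weight_vector_degree (sg : int) (Q : set (cplx vf -> R[i])) v :
  (forall (j : int) alpha, -2 <= j <= 2 -> 0 < sg * j ->
     roots_of cbr (cplx_set s) h alpha ->
     alpha (cplx_in Es) = j%:~R -> Q alpha) ->
  highest_weight_vector cbr (cplx_set s) h Q (cplx_set W) v ->
  exists b : int, [/\ -2 <= b <= c,
    cbr (cplx_in Es) v = (b%:~R + lam)%:C *: v &
    forall b' Y, gr W b' Y -> Y <> 0 -> sg * b' <= sg * b].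
Proof.
move=> Qroots [Wv v0 [mu muv] Qv].
have Esv : cbr (cplx_in Es) v = cbr (cplx_in E) v + lam%:C *: v.
  have [Wv1 Wv2] := Wv.
  by rewrite !cplx_br_in// cplx_scale_real (EsE Wv1) (EsE Wv2).
have Ev : cbr (cplx_in E) v = (mu (cplx_in Es) - lam%:C) *: v.
  by rewrite scalerBl -muv// Esv addrK.
have [b [bc muE]] := graded_eigenvalue gW Wv v0 Ev.
have mu_blam : mu (cplx_in Es) = (b%:~R + lam)%:C.
  by rewrite rmorphD /= rmorph_int -muE subrK.
exists b; split; first exact: bc.
  by rewrite -mu_blam; exact: muv.
move=> b' Y gY Y0.
have kill j Z : -2 <= j <= 2 -> 0 < sg * j -> gr s j Z ->
    br Z v.1 = 0 /\ br Z v.2 = 0.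
  move=> j2 j0 [sZ eZ].
  have : cbr (cplx_in Z) v = 0.
    apply: (root_vectors_kill cbrL (subspace_cplx_set ss) _ hh.1 _ hEsh
              (P := Q) (j := j%:~R)) => //.
    - move=> [x1 x2] [y1 y2] [/= sx1 sx2] [/= sy1 sy2]; split=> /=.
        by apply: subspaceD => //; [|apply: subspaceN => //]; exact: sLie.
      by apply: subspaceD => //; exact: sLie.
    - apply: findim_sub (findim_cplx_set (graded_findim gs)).
      by have [[_ + _ _] _] := hh.
    - by rewrite intr_eq0; apply: contraTneq j0 => ->; rewrite mulr0.
    - by move=> alpha ra aj; exact: (Qroots j).
    - by split=> //=; exact: subspace0.
    - rewrite cplx_br_in//= (br0r brL) -euler_grading_element// eZ.
      by rewrite -(rmorph_int (real_complex R)) cplx_scale_real /= scaler0.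
  by rewrite cplx_br_in// => -[].
have gv : gr W b v.1 /\ gr W b v.2.
  move: Ev; rewrite muE cplx_br_in// -(rmorph_int (real_complex R)).
  rewrite cplx_scale_real.
  by case=> e1 e2; have [] := Wv; split; split.
(* [extremal_degree] concerns real fields; the real or the imaginary part of [v], whichever is
   nonzero, is taken. *)
have [X [gX X0 killX]] : exists X, [/\ gr W b X, X <> 0 &
    forall j Z, -2 <= j <= 2 -> 0 < sg * j -> gr s j Z -> br Z X = 0].
  have [v1|v1] := pselect (v.1 = 0); last first.
    by exists v.1; split=> // [|j Z j2 j0 /(kill j Z j2 j0)[]//]; case: gv.
  exists v.2; split=> // [|v2|j Z j2 j0 /(kill j Z j2 j0)[]//].
    by case: gv.
  by apply: v0; rewrite [v]surjective_pairing v1 v2.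
exact: extremal_degree gX X0 killX gY Y0.
Qed.

(** This matches the form in which positivity is assumed: as Es lies in the Cartan subalgebra, the
    value of [alpha] there is the degree of its root vectors. *)
Lemma grading_root_space (j : int) alpha : 1 <= j <= 2 ->
  alpha (cplx_in Es) = j%:~R ->
  root_space cbr (cplx_set s) h alpha
    `<=` cplx_set [set X + Y | X in gr s 1 & Y in gr s 2].
Proof.
move=> j12 aj [x y] [[/= sx sy] /(_ _ hEsh)].
rewrite aj cplx_br_in// -(rmorph_int (real_complex R)) cplx_scale_real.
case=> ex ey.
have gr0 i : gr s i 0 by apply: subspace0; exact: subspace_eigensp.
have in12 z : s z -> br Es z = j%:~R *: z ->
    [set X + Y | X in gr s 1 & Y in gr s 2] z.
  move=> sz ez; have gz : gr s j z by split=> //; rewrite euler_grading_element.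
  have /orP[/eqP j1|/eqP j2] : (j == 1) || (j == 2) by lia.
    by rewrite j1 in gz; exists z => //; exists 0; rewrite ?addr0.
  by rewrite j2 in gz; exists 0 => //; exists z; rewrite ?add0r.
by split; exact: in12.
Qed.

End LeviRepresentation.

End GradedModule.

Theorem proposition12 (R : realType) (n k : nat) (H : 'I_k -> 'M[R[i]]_n)
    (hk : (1 <= k <= n ^ 2)%N)
    (hH : forall j, conjtr (H j) = H j)
    (hnd : nondegenerate_model H)
    (s Rad : set (vfield R (n + k)))
    (hlevi : levi_decomposition vf_bracket (aut_germs H) s Rad)
    (hcomp : compatible_with_grading (aut_germs H) s Rad)
    (Es : vfield R (n + k)) (hEs : grading_element s Es)
    (W : set (vfield R (n + k)))
    (hWR : W `<=` Rad)
    (hWirr : irreducible_subrep vf_bracket s W)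
    (c : int)
    (hWgr : graded W (-2) c)
    (hWlo : gr W (-2) <> [set 0])
    (hWhi : gr W c <> [set 0])
    (h : set (cplx (vfield R (n + k))))
    (hh : cartan_subalgebra (cplx_br vf_bracket) (cplx_set s) h)
    (hEsh : h (cplx_in Es))
    (P : set (cplx (vfield R (n + k)) -> R[i]))
    (hP : positive_system (cplx_br vf_bracket) (cplx_set s) h P)
    (hPpos : forall alpha,
       roots_of (cplx_br vf_bracket) (cplx_set s) h alpha ->
       root_space (cplx_br vf_bracket) (cplx_set s) h alpha
         `<=` cplx_set [set X + Y | X in gr s 1 & Y in gr s 2] ->
       P alpha)
    (vmax vmin : cplx (vfield R (n + k)))
    (hvmax : highest_weight_vector (cplx_br vf_bracket)
               (cplx_set s) h P (cplx_set W) vmax)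
    (hvmin : lowest_weight_vector (cplx_br vf_bracket)
               (cplx_set s) h P (cplx_set W) vmin) :
  exists Kmax Kmin : R,
    [/\ cplx_br vf_bracket (cplx_in Es) vmax = Kmax%:C *: vmax,
        cplx_br vf_bracket (cplx_in Es) vmin = Kmin%:C *: vmin,
        (* (1) *)
        [/\ is_eigenvalue vf_bracket W Es Kmax,
            is_eigenvalue vf_bracket W Es Kmin &
            forall mu : R[i],
              is_eigenvalue (cplx_br vf_bracket) (cplx_set W)
                (cplx_in Es) mu ->
              Kmin%:C <= mu <= Kmax%:C],
        (* (2) *)
        (forall i : int, -2 <= i <= c ->
           gr W i = eigensp vf_bracket W Es
                      (i%:~R + Kmin + 2)) /\
        c%:~R = Kmax - Kmin - 2
      & (* (3) *)
        forall X, gr W c X ->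
          weighted_homogeneous (Kmax - Kmin - 2) X /\
          at_least_jet_determined (Num.floor ((Kmax - Kmin) / 2)) X].
Proof.
have brL := @vf_lie_bracket R (n + k); have cbrL := cplx_lie_bracket brL.
have [_ [ss _ sLie] semis _ _] := hlevi.
have [_ gs _ _ _] := hcomp.
have sW : subspace W by case: hWirr => -[].
have [lam EsE] := shift_scalar ss sLie semis gs hEs hWirr hWgr.
have pos_P (j : int) alpha : 1 <= j <= 2 ->
    roots_of (cplx_br vf_bracket) (cplx_set s) h alpha ->
    alpha (cplx_in Es) = j%:~R -> P alpha.
  by move=> j12 ra aj; apply: hPpos => //; exact: grading_root_space j12 aj.
have [Proots _ _] := hP.
have [|bmax [bmaxc Emax maxW]] :=
    weight_vector_degree (sg := 1) ss sLie gs hEs hWirr hWgr EsE hh hEsh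
      _ hvmax.
  move=> j alpha j2 j0 ra aj; apply: (pos_P j) => //; lia.
have [|bmin [bminc Emin minW]] :=
    weight_vector_degree (sg := -1) ss sLie gs hEs hWirr hWgr EsE hh hEsh
      _ hvmin.
  (* Here [j] is negative. If [alpha] is in [P], its opposite is a root of positive degree [- j],
     hence also in [P], which puts [alpha] in [opp_roots P]. *)
  move=> j alpha j2 j0 ra aj; move: (ra); rewrite Proots => -[Pa|//].
  have Na : roots_of (cplx_br vf_bracket) (cplx_set s) h (- alpha).
    by rewrite Proots; right; exists alpha.
  exists (- alpha); last by rewrite opprK.
  apply: (pos_P (- j)) => //; first by lia.
  by rewrite -[LHS]/(- alpha (cplx_in Es)) aj rmorphN.
have sgr i : subspace (gr W i) by apply: subspace_eigensp.
have [Xlo glo lo0] := nonzero_of_neq0 (sgr _) hWlo.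
have [Xhi ghi hi0] := nonzero_of_neq0 (sgr _) hWhi.
(* The bounds on all degrees in [W] are applied to the nonzero extreme components. *)
have bmaxE : bmax = c by have := maxW _ _ ghi hi0; lia.
have bminE : bmin = -2 by have := minW _ _ glo lo0; lia.
rewrite {}bmaxE {bmaxc maxW} in Emax; rewrite {}bminE {bminc minW} in Emin.
have grE (b : int) : gr W b = eigensp vf_bracket W Es (b%:~R + lam).
  apply/seteqP; split => X [WX eX]; split=> //.
    by rewrite EsE// eX scalerDl.
  by move: eX; rewrite EsE// scalerDl => /addIr.
(* The extreme degrees [c] and -2, shifted by [lam]; the 2 in the formulas undoes the lowest
   degree. *)
exists (c%:~R + lam), ((-2)%:~R + lam).
have Kdiff : c%:~R + lam - ((-2)%:~R + lam) - 2 = c%:~R :> R.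
  by rewrite rmorphN /=; ring.
split=> //.
- split.
  + by exists Xhi; rewrite -?grE.
  + by exists Xlo; rewrite -?grE.
  (* [mu - lam] is an eigenvalue of E, hence an integer between -2 and [c]; this also gives the
     reality of [mu] that the order on [R[i]] demands. *)
  + move=> mu [v [Wv Ev] v0].
    have EvE : cplx_br vf_bracket (cplx_in euler) v = (mu - lam%:C) *: v.
      have [Wv1 Wv2] := Wv; rewrite scalerBl -Ev !cplx_br_in//.
      rewrite (EsE _ Wv1) (EsE _ Wv2) cplx_scale_real.
      by congr (_, _); rewrite /= addrK.
    have [b [bc muE]] := graded_eigenvalue hWgr Wv v0 EvE.
    have -> : mu = (b%:~R + lam)%:C by rewrite rmorphD /= rmorph_int -muE subrK.
    by rewrite !lecR !lerD2r !ler_int.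
- split; last by rewrite Kdiff.
  move=> i _; rewrite grE; congr eigensp.
  by rewrite rmorphN /=; ring.
- move=> X gX; rewrite Kdiff; split; first exact: gr_weighted_homogeneous gX.
  have -> : c%:~R + lam - ((-2)%:~R + lam) = c%:~R + 2 :> R.
    by rewrite rmorphN /=; ring.
  exact: gr_jet_determined gX.
Qed.
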